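(* Let $(P,\pi)$ be an $n$-dimensional complex Poisson manifold, let $p_0\in P$ with $\pi(p_0)=0$, and let $\pi_0$ be the linearization of $\pi$ at $p_0$, a linear Poisson structure on $T_{p_0}P$. Let $\Phi=\{\varphi_1,\dots,\varphi_n\}$ be a log-canonical system on $(P,\pi)$ at $p_0$, with log-volume form $$\mu_\Phi=\frac{d\varphi_1\wedge\cdots\wedge d\varphi_n}{\varphi_1\cdots\varphi_n}.$$ Then, taking lowest degree terms at $p_0$, the condition $\deg(\mu_\Phi^{\rm low})\le \tfrac12{\rm rk}(\pi_0)$ is equivalent to the condition $\deg(\mu_\Phi^{\rm low})=\tfrac12{\rm rk}(\pi_0)$; and if this condition holds, then the set $\Phi^{\rm low}=\{\varphi_1^{\rm low},\dots,\varphi_n^{\rm low}\}$ contains a polynomial integrable system on $(T_{p_0}P,\pi_0)$.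
   Context: Poisson notions. A complex Poisson manifold $(P,\pi)$ is a complex manifold with a holomorphic Poisson bivector field $\pi$; $\{\varphi,\psi\}_\pi=\pi(d\varphi,d\psi)$. The rank ${\rm rk}(\pi)$ is the maximum over $p\in P$ of the rank of $\pi(p)$. If $\pi(p_0)=0$, the linearization $\pi_0$ of $\pi$ at $p_0$ is the linear Poisson structure on the vector space $T_{p_0}P$ determined by $\{d_{p_0}\varphi,d_{p_0}\psi\}_{\pi_0}=d_{p_0}(\{\varphi,\psi\}_\pi)$ for local holomorphic functions $\varphi,\psi$ near $p_0$, where covectors are viewed as linear functions on $T_{p_0}P$. Log-canonical systems. With $n=\dim P$, a log-canonical system at $p_0$ is a set $\Phi=\{\varphi_1,\dots,\varphi_n\}$ of holomorphic functions on a (connected) open neighborhood of $p_0$ such that $\{\varphi_i,\varphi_j\}_\pi\in\mathbb C\,\varphi_i\varphi_j$ for all $i,j$ and $d\varphi_1\wedge\cdots\wedge d\varphi_n\ne0$ (as an $n$-form). Lowest degree terms at $p_0$. Let $z=(z_1,\dots,z_n)$ be local holomorphic coordinates near $p_0$ with $z(p_0)=0$, and also write $z_j$ for the linear coordinate $d_{p_0}z_j$ on $T_{p_0}P$. For a non-zero holomorphic $\varphi=\sum_\epsilon c_\epsilon z^\epsilon$, let $e$ be the smallest $\epsilon_1+\cdots+\epsilon_n$ with $c_\epsilon\neq0$; then $\varphi^{\rm low}=\sum_{\epsilon_1+\cdots+\epsilon_n=e}c_\epsilon z^\epsilon$, a homogeneous polynomial on $T_{p_0}P$ of degree $e$, independent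 of coordinates. For a non-zero holomorphic $k$-form $\alpha$ near $p_0$, let $e$ be the smallest total degree in $z$ of a monomial occurring in the Taylor expansions of the coefficients of $\alpha$; $\alpha^{\rm low}$ is obtained by keeping only the monomials of degree $e$ in the coefficients, and $\deg(\alpha^{\rm low})=e+k$. For a meromorphic form $\alpha=\alpha_1/\varphi$ with $\alpha_1,\varphi$ holomorphic, $\alpha^{\rm low}=\alpha_1^{\rm low}/\varphi^{\rm low}$ and $\deg(\alpha^{\rm low})=\deg(\alpha_1^{\rm low})-\deg(\varphi^{\rm low})$. A polynomial integrable system on $(T_{p_0}P,\pi_0)$ is a set of $n-\frac12{\rm rk}(\pi_0)$ algebraically independent polynomials on $T_{p_0}P$ with pairwise zero Poisson brackets with respect to $\pi_0$. *)

(* Defs.v *)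
From HB Require Import structures.
From mathcomp Require Import all_boot all_order all_algebra complex.
From mathcomp Require Import all_classical all_reals all_analysis.
(* The notations of mpoly clash with those of MathComp-Analysis. *)
From mathcomp Require Import -(notations) mpoly.

Set Implicit Arguments.
Unset Strict Implicit.
Unset Printing Implicit Defensive.

Import Order.TTheory GRing.Theory Num.Theory.
Import numFieldNormedType.Exports.

Local Open Scope classical_set_scope.
Local Open Scope ring_scope.

(* Bundling R[i] as a numClosedFieldType gives it the canonical topology and
   norm that MathComp-Analysis puts on every numClosedFieldType. *)
Definition Cx (R : realType) : numClosedFieldType := R[i].

Section Holomorphic.
Context {R : realType} {n : nat}.
Local Notation C := (Cx R).
Implicit Types (f : 'rV[C]_n -> C) (a : 'rV[C]_n) (c : multinom n -> C).

(* [bmultinom n N] is the finite type of exponents of total degree < N. The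
   first condition is absolute convergence on the polydisc of radius r, so that
   summing by total degree is no restriction. *)
Definition has_expansion f a c : Prop :=
  exists2 r : C, 0 < r &
    (exists M : C, forall N : nat,
       \sum_(m : bmultinom n N) `|c m| * r ^+ mdeg m <= M) /\
    (forall z : 'rV[C]_n, (forall j, `|z 0 j| < r) ->
       (fun N : nat => \sum_(m : bmultinom n N) c m * \prod_(j < n) z 0 j ^+ m j)
         @ \oo --> f (a + z)).

Definition holomorphic_at f a : Prop := exists c, has_expansion f a c.

Definition partial (i : 'I_n) f a : C := 'D_(delta_mx 0 i) f a.

(* The Taylor coefficients of f at a (zero by convention if f is not
   holomorphic at a). *)
Definition taylor f a : multinom n -> C :=
  xget (fun=> 0) [set c | has_expansion f a c].

(* The least element of a non-empty set of natural numbers. *)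
Definition least (A : set nat) : nat :=
  xget 0%N [set e | A e /\ forall e', A e' -> (e <= e')%N].

Definition low_deg f a : nat :=
  least [set e | exists m : multinom n, taylor f a m != 0 /\ mdeg m = e].

Definition low f a : mpoly n C :=
  \sum_(m : bmultinom n (low_deg f a).+1 | mdeg m == low_deg f a)
    taylor f a m *: mpolyX C m.

(* A k-form on an open subset of C^n, given by all its coefficients
   alpha(d/dz_{J 0}, ..., d/dz_{J (k-1)}); up to sign, the non-zero ones are the
   coefficients on the basis dz_{J 0} /\ ... /\ dz_{J (k-1)}, J increasing. *)
Definition kform (k : nat) := ('I_k -> 'I_n) -> 'rV[C]_n -> C.

(* d f_0 /\ ... /\ d f_(k-1) *)
Definition dwedge (k : nat) (f : 'I_k -> 'rV[C]_n -> C) : kform k :=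
  fun J x => \det (\matrix_(i, j) partial (J j) (f i) x).

Definition form_low_deg (k : nat) (alpha : kform k) a : nat :=
  addn (least [set e | exists J, exists m : multinom n,
                 taylor (alpha J) a m != 0 /\ mdeg m = e]) k.

(* The degree of the lowest degree term of the meromorphic form alpha / f. *)
Definition mero_low_deg (k : nat) (alpha : kform k) f a : int :=
  (form_low_deg alpha a)%:Z - (low_deg f a)%:Z.

Definition log_volume_low_deg (f : 'I_n -> 'rV[C]_n -> C) a : int :=
  mero_low_deg (dwedge f) (fun x => \prod_(i < n) f i x) a.

End Holomorphic.

(* [cinv] is relevant only on the image of [cdom] by [cmap]. *)
Record chart (R : realType) (n : nat) (P : topologicalType) := Chart {
  cdom : set P;
  cmap : P -> 'rV[Cx R]_n;
  cinv : 'rV[Cx R]_n -> P;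
  cdom_open : open cdom;
  cimg_open : open (cmap @` cdom);
  cmapK : forall p, cdom p -> cinv (cmap p) = p;
  cmap_cont : {within cdom, continuous cmap};
  cinv_cont : {within cmap @` cdom, continuous cinv}
}.

Definition compatible (R : realType) (n : nat) (P : topologicalType)
    (c d : chart R n P) : Prop :=
  forall p, cdom c p -> cdom d p -> forall i,
    holomorphic_at (fun x => cmap d (cinv c x) 0 i) (cmap c p).

(* [atlas] is the maximal atlas: the set of all local holomorphic coordinate
   systems. *)
Record complex_manifold (R : realType) (n : nat) := ComplexManifold {
  carrier :> topologicalType;
  atlas : set (chart R n carrier);
  manifold_hausdorff : hausdorff_space carrier;
  manifold_second_countable : @second_countable carrier;
  atlas_cover : forall p, exists2 c, atlas c & cdom c p;
  atlas_compatible : forall c d, atlas c -> atlas d -> compatible c d;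
  atlas_maximal : forall c,
    (forall d, atlas d -> compatible c d /\ compatible d c) -> atlas c
}.

Arguments atlas {R n} _ _.

Section Poisson.
Context {R : realType} {n : nat} (P : complex_manifold R n).
Local Notation C := (Cx R).
Implicit Types (c d : chart R n P) (p : P) (U : set P) (phi psi : P -> C).

Definition incoord c phi : 'rV[C]_n -> C := fun x => phi (cinv c x).

Definition holomorphic_on U phi : Prop :=
  forall c p, atlas P c -> cdom c p -> U p ->
    holomorphic_at (incoord c phi) (cmap c p).

Definition dchart c (i : 'I_n) phi p : C :=
  partial i (incoord c phi) (cmap c p).

(* The bracket pi(d phi, d psi) in the chart c, for a bivector field with
   components w p i j = pi(d z_i, d z_j)(p) in c. *)
Definition bracket_in c (w : P -> 'M[C]_n) phi psi : P -> C :=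
  fun p => \sum_i \sum_j w p i j * dchart c i phi p * dchart c j psi p.

(* [bv c p i j] is the component pi(d z_i, d z_j)(p) in the chart c = (z_i);
   [bv_change] is the transformation law of contravariant 2-tensors. *)
Record poisson_structure := PoissonStructure {
  bv : chart R n P -> P -> 'M[C]_n;
  bv_holomorphic : forall c, atlas P c -> forall i j,
    holomorphic_on (cdom c) (fun p => bv c p i j);
  bv_antisymmetric : forall c p, atlas P c -> cdom c p ->
    (bv c p)^T = - bv c p;
  bv_change : forall c d p, atlas P c -> atlas P d -> cdom c p -> cdom d p ->
    let J := \matrix_(k, i) dchart c i (fun q => cmap d q 0 k) p in
    bv d p = J *m bv c p *m J^T;
  bv_jacobi : forall c U phi psi chi, atlas P c -> open U -> U `<=` cdom c ->
    holomorphic_on U phi -> holomorphic_on U psi -> holomorphic_on U chi ->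
    let br := bracket_in c (bv c) in
    forall p, U p -> br phi (br psi chi) p + br psi (br chi phi) p
                     + br chi (br phi psi) p = 0
}.

Variable pi : poisson_structure.

(* {phi, psi}_pi on the domain of c; by [bv_change] it does not depend on c. *)
Definition bracket c phi psi : P -> C := bracket_in c (bv pi c) phi psi.

Definition vanishes_at p : Prop :=
  forall c, atlas P c -> cdom c p -> bv pi c p = 0.

Definition log_canonical_system p0 (Phi : 'I_n -> P -> C) : Prop :=
  exists U : set P,
    [/\ open U, connected U & U p0] /\
    [/\ forall i, holomorphic_on U (Phi i),
        forall i j, exists lambda : C, forall c p,
          atlas P c -> cdom c p -> U p ->
          bracket c (Phi i) (Phi j) p = lambda * (Phi i p * Phi j p) &
        exists c p J, [/\ atlas P c, cdom c p, U p &
          dwedge (fun i => incoord c (Phi i)) J (cmap c p) != 0]].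

End Poisson.

(* Poisson structures on the vector space T_{p0} P with polynomial components;
   the variable j stands for the linear coordinate d_{p0} z_j. *)
Section LinearPoisson.
Context {R : realType} {n : nat}.
Local Notation C := (Cx R).
Implicit Types (w : 'M[mpoly n C]_n) (f g h : mpoly n C).

Definition poly_bracket w f g : mpoly n C :=
  \sum_i \sum_j w i j * mderiv i f * mderiv j g.

Definition linear_poisson w : Prop :=
  [/\ w^T = - w,
      forall i j, w i j \is ishomog1 1 mdeg &
      forall f g h, poly_bracket w f (poly_bracket w g h)
        + poly_bracket w g (poly_bracket w h f)
        + poly_bracket w h (poly_bracket w f g) = 0].

(* The maximum over all points x of the rank of w at x. *)
Definition poisson_rank w : nat :=
  (\max_(r < n.+1 |
     `[< exists x : 'I_n -> C, \rank (map_mx (meval x) w) = r >]) r)%N.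

Definition alg_independent (s : seq (mpoly n C)) : Prop :=
  forall q : mpoly (size s) C, comp_mpoly (in_tuple s) q = 0 -> q = 0.

Definition poly_integrable_system w (s : seq (mpoly n C)) : Prop :=
  [/\ uniq s,
      (size s)%:R = n%:R - (poisson_rank w)%:R / 2 :> rat,
      alg_independent s &
      forall f g, f \in s -> g \in s -> poly_bracket w f g = 0].

End LinearPoisson.

Section Linearization.
Context {R : realType} {n : nat} (P : complex_manifold R n).
Local Notation C := (Cx R).

(* d_{p0} phi, as a linear function on T_{p0} P. *)
Definition dlinear (z : chart R n P) (p0 : P) (phi : P -> C) : mpoly n C :=
  \sum_j dchart z j phi p0 *: mpolyX C (mnm1 j).

Definition is_linearization (pi : poisson_structure P) (z : chart R n P)
    (p0 : P) (pi0 : 'M[mpoly n C]_n) : Prop :=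
  linear_poisson pi0 /\
  forall (U : set P) (phi psi : P -> C), open U -> U p0 ->
    holomorphic_on U phi -> holomorphic_on U psi ->
    poly_bracket pi0 (dlinear z p0 phi) (dlinear z p0 psi)
      = dlinear z p0 (bracket pi z phi psi).

End Linearization.

(* Main.v *)
Require Import Defs.
From HB Require Import structures.
From mathcomp Require Import all_boot all_order all_algebra complex.
From mathcomp Require Import all_classical all_reals all_analysis.
From mathcomp Require Import ring lra.
From mathcomp Require Import -(notations) ssrcomplements mpoly.
Import Order.TTheory GRing.Theory Num.Theory.
Import numFieldNormedType.Exports.
Set Implicit Arguments.
Unset Strict Implicit.
Unset Printing Implicit Defensive.
Local Open Scope classical_set_scope.
Local Open Scope ring_scope.

(** Write [f_i] for the functions [Phi i] in the chart [z], [e i] for their lowest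
    degrees, [g_i] for their lowest degree terms, and [r] for the rank, over the
    field of rational functions, of the Jacobian matrix of the [g_i]. The theorem
    follows from

      [half_rk <= n - r <= deg_mu].

    - First inequality. As [pi] vanishes at [p0], the terms of degree
      [e i + e j - 1] in [{f_i, f_j} = l f_i f_j] say that the [g_i] commute for
      [pi0] ([low_commute]). Their differentials span an isotropic subspace, so
      [2 r + rk <= 2 n] ([rank_low_jacobian]).

    - Second inequality. In the determinant of the [d f_i = d g_i + d (f_i - g_i)]
      at most [r] rows can be taken among the [d g_i]. A row [d g_i] has degree
      [e i - 1], and a row [d (f_i - g_i)] has degree at least [e i]: the
      determinant has order at least [\sum_i e i - r] ([ord_ge_dwedge]).

    If [deg_mu = half_rk] then [r = n - half_rk]; choosing [r] of the [g_i] with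
    independent differentials gives an integrable system, by the Jacobian
    criterion [jacobian_alg_independent].

    The rest is the calculus of germs of holomorphic functions of several
    variables. Everything is phrased with [ord_ge f a k], that is
    [f (a + z) = O(|z| ^ k)], which determines the Taylor coefficients
    ([has_expansion_ord_geP]); sums, products and derivatives of convergent power
    series are handled through norms of their partial sums. The non-degeneracy of
    a log-canonical system is only assumed at some point of a connected open set,
    possibly far from [p0]; the identity theorem transports it to the germ at
    [p0] ([jac_germ_neq0]). *)

(** * Ranks, determinants, and the Jacobian criterion *)

Section Ranks.

(** Multilinearity of the determinant in the rows, expanded all at once: each
    subset [S] records the rows taken from [A]. *)
Lemma det_add_sum (K : comNzRingType) n (A B : 'M[K]_n) :
  \det (A + B) = \sum_(S : {set 'I_n})
     \det (\matrix_(i, j) (if i \in S then A i j else B i j)).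
Proof.
rewrite /determinant exchange_big /=; apply: eq_bigr => s _.
rewrite -mulr_sumr; congr (_ * _).
under eq_bigr do rewrite mxE.
rewrite bigA_distr; apply: eq_bigr => S _; apply: eq_bigr => i _.
by rewrite mxE.
Qed.

Lemma mxrank_rowsub_le (K : fieldType) m m' n (f : 'I_m' -> 'I_m) (A : 'M[K]_(m, n)) :
  (\rank (rowsub f A) <= \rank A)%N.
Proof. by rewrite -[A]mul1mx -mul_rowsub_mx mul1mx mxrankM_maxr. Qed.

Lemma mxrank_colsub_le (K : fieldType) m n n' (f : 'I_n' -> 'I_n) (A : 'M[K]_(m, n)) :
  (\rank (colsub f A) <= \rank A)%N.
Proof. by rewrite -mxrank_tr trmx_mxsub -[leqRHS]mxrank_tr mxrank_rowsub_le. Qed.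

(** If the determinant is non-zero then the rows in [S], which are rows of [A],
    are independent. *)
Lemma det_mixed_eq0 (K : fieldType) n (A B : 'M[K]_n) (S : {set 'I_n}) :
  (\rank A < #|S|)%N ->
  \det (\matrix_(i, j) (if i \in S then A i j else B i j)) = 0.
Proof.
set D := \matrix_(i, j) _ => AS; apply/eqP; rewrite -[_ == 0]negbK -unitfE -unitmxE.
rewrite -row_free_unit; apply: contraL AS => freeD; rewrite -leqNgt.
(* A right inverse of D, with its columns selected along S, is a right inverse
   of the rows of D in S. *)
have -> : #|S| = \rank (rowsub (enum_val : 'I_#|S| -> 'I_n) D).
  apply/esym/eqP; rewrite -/(row_free _); apply/row_freeP.
  have /row_freeP[D' DD'] := freeD.
  exists (D' *m (rowsub (enum_val : 'I_#|S| -> 'I_n) 1%:M)^T).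
  rewrite mulmxA !mul_rowsub_mx DD' mul1mx.
  by apply/matrixP => i j; rewrite !mxE eq_sym (inj_eq enum_val_inj).
have -> : rowsub (enum_val : 'I_#|S| -> 'I_n) D = rowsub (enum_val : 'I_#|S| -> 'I_n) A.
  by apply/matrixP => i j; rewrite !mxE enum_valP.
exact: mxrank_rowsub_le.
Qed.

(** A non-zero minor of the specialized matrix comes from a minor of [W] that is
    non-zero in [T], hence in the fraction field: rank can only drop when the
    generic point is specialized. *)
Lemma mxrank_specialize (T : idomainType) (K : fieldType) (phi : {rmorphism T -> K})
    m n (W : 'M[T]_(m, n)) :
  (\rank (map_mx phi W) <= \rank (map_mx (@tofrac T) W))%N.
Proof.
set B := map_mx phi W; pose f1 := maxrankfun B.
have B1 : row_full (rowsub f1 B)^T.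
  by rewrite /row_full mxrank_tr; apply: (maxrowsub_free B).
pose f2 := fullrankfun B1.
have := fullrowsub_unit B1; rewrite -/f2 => D1.
pose D := mxsub f1 f2 W.
have D0 : \det D != 0.
  have : \det (map_mx phi D) != 0.
    rewrite -unitfE -unitmxE -unitmx_tr.
    by congr (_ \in unitmx): D1; apply/matrixP => i j; rewrite !mxE.
  by rewrite det_map_mx; apply: contraNneq => ->; rewrite rmorph0.
have DF : map_mx (@tofrac T) D \in unitmx.
  by rewrite unitmxE det_map_mx unitfE tofrac_eq0.
rewrite -(mxrank_unit DF) map_mxsub.
rewrite (_ : mxsub _ _ _ = rowsub f1 (colsub f2 (map_mx (@tofrac T) W))); last first.
  by apply/matrixP => i j; rewrite !mxE.
exact: leq_trans (mxrank_rowsub_le _ _) (mxrank_colsub_le _ _).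
Qed.

(** The rows of [M] span an isotropic subspace for [w]: [M *m w] has rank at
    least [\rank M + \rank w - n], and its rows are killed by [M^T]. *)
Lemma mxrank_isotropic (K : fieldType) m n (M : 'M[K]_(m, n)) (w : 'M[K]_n) :
  M *m w *m M^T = 0 -> (\rank M + \rank M + \rank w <= n + n)%N.
Proof.
move=> /mulmx0_rank_max; rewrite mxrank_tr => H.
have := mxrank_mul_min M w; rewrite leq_subLR => H2.
by rewrite addnAC (leq_trans (leq_add H2 (leqnn _)))// -addnA leq_add2l.
Qed.

Lemma row_free_cast (K : fieldType) k1 k2 m (E : k1 = k2) (X : 'M[K]_(k2, m)) :
  row_free X -> row_free (rowsub (cast_ord E) X).
Proof.
case: k2 / E X => X; rewrite (_ : rowsub _ X = X)//.
by apply/matrixP => i j; rewrite !mxE cast_ord_id.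
Qed.

Lemma mulmx_matrixE (K : comNzRingType) n (A B : 'I_n -> 'I_n -> K) :
  (\matrix_(i, k) A i k) *m (\matrix_(k, j) B k j) =
  \matrix_(i, j) \sum_k A i k * B k j.
Proof. by apply/matrixP => i j; rewrite !mxE; under eq_bigr do rewrite !mxE. Qed.

Lemma sum_delta2 (K : comNzRingType) n (w : 'M[K]_n) (i j : 'I_n) :
  \sum_a \sum_b w a b * (i == a)%:R * (j == b)%:R = w i j.
Proof.
rewrite (bigD1 i)//= (bigD1 j)//= !eqxx !mulr1 big1 ?addr0; last first.
  by move=> b bj; rewrite eq_sym (negPf bj) mulr0.
rewrite big1 ?addr0// => a ai; apply: big1 => b _.
by rewrite [i == a]eq_sym (negPf ai) mulr0 mul0r.
Qed.

Lemma tnth_map_enum (T : Type) k (h : 'I_k -> T)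
    (E : size [seq h i | i <- enum 'I_k] = k) i :
  tnth (in_tuple [seq h i | i <- enum 'I_k]) i = h (cast_ord E i).
Proof.
have ik : (i < k)%N := ltn_ord (cast_ord E i).
have ik' : (i < size (enum 'I_k))%N by rewrite size_enum_ord.
rewrite (tnth_nth (h (cast_ord E i))) (nth_map (cast_ord E i))//; congr (h _).
by apply: val_inj; rewrite /= nth_enum_ord.
Qed.

End Ranks.

(** The successor step of inductions on the total degree of a monomial. *)
Lemma mdeg_succ n (m : multinom n) d : mdeg m = d.+1 ->
  exists i m', m = mnm_add m' (mnm1 i) /\ mdeg m' = d.
Proof.
move=> md; have [i mi] : exists i, m i != 0%N.
  apply/existsP; move: (md) => /eqP; apply: contraTT.
  rewrite negb_exists mdegE => /forallP H.
  by rewrite big1// => j _; apply/eqP/negPn/H.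
have em : mnm_add (mnm_sub m (mnm1 i)) (mnm1 i) = m by rewrite submK// lep1mP.
exists i, (mnm_sub m (mnm1 i)); split=> //.
by apply/eqP; rewrite -eqSS -md -{2}em mdegD mdeg1 addn1.
Qed.

Section Jacobian.
Variables (C : numFieldType) (n : nat).
Local Notation poly := (mpoly n C).

(** Both sides are derivations in [q] that agree on the variables. *)
Lemma mderiv_comp k (lq : k.-tuple poly) (q : mpoly k C) (j : 'I_n) :
  mderiv j (comp_mpoly lq q) =
  \sum_i comp_mpoly lq (mderiv i q) * mderiv j (tnth lq i).
Proof.
have XE (m : multinom k) : mderiv j (comp_mpoly lq (mpolyX C m)) =
    \sum_i comp_mpoly lq (mderiv i (mpolyX C m)) * mderiv j (tnth lq i).
  elim: {m}(mdeg m) {-2}m (erefl (mdeg m)) => [|d IH] m md.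
    have /eqP -> : m == mnm0 by rewrite -mdeg_eq0 md.
    rewrite mpolyX0 comp_mpoly1 -mpolyC1 mderivC big1// => i _.
    by rewrite mderivC comp_mpoly0 mul0r.
  have [i [m' [-> m'd]]] := mdeg_succ md.
  rewrite mpolyXD rmorphM /= mderivM IH// mulr_suml.
  have -> : mderiv j (comp_mpoly lq (mpolyX C (mnm1 i))) =
     \sum_l comp_mpoly lq (mderiv l (mpolyX C (mnm1 i))) * mderiv j (tnth lq l).
    rewrite (bigD1 i)//= big1 ?addr0.
      rewrite mderivX mnm1E eqxx scale1r.
      rewrite (_ : mnm_sub _ _ = mnm0); last by apply/mnmP => l; rewrite mnmBE subnn mnm0E.
      by rewrite mpolyX0 comp_mpoly1 mul1r comp_mpolyXU -tnth_nth.
    move=> l li; rewrite mderivX mnm1E eq_sym (negPf li) scale0r.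
    by rewrite comp_mpoly0 mul0r.
  rewrite mulr_sumr -big_split /=; apply: eq_bigr => l _.
  by rewrite mderivM rmorphD !rmorphM /= mulrDl mulrA [in RHS]mulrAC.
rewrite {1}[q]mpolyE [comp_mpoly lq (\sum_(_ <- _) _)]raddf_sum.
rewrite [mderiv j (\sum_(_ <- _) _)]raddf_sum /=.
under eq_bigr do rewrite comp_mpolyZ mderivZ XE scaler_sumr.
rewrite exchange_big /=; apply: eq_bigr => i _.
rewrite [in RHS](mpolyE q) [mderiv i _]raddf_sum /= [comp_mpoly lq _]raddf_sum /= mulr_suml.
by apply: eq_bigr => m _; rewrite mderivZ comp_mpolyZ scalerAl.
Qed.

(** An algebraic relation between the [lq] differentiates to a linear relation
    between their differentials; the partial derivatives of a relation are thus
    relations of smaller degree, and they vanish by induction on the degree. In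
    characteristic 0 this leaves only constant relations. *)
Lemma jacobian_alg_independent k (lq : k.-tuple poly) :
  row_free (\matrix_(i < k, j < n) tofrac (mderiv j (tnth lq i))) ->
  forall q : mpoly k C, comp_mpoly lq q = 0 -> q = 0.
Proof.
move=> freeM q; elim: {q}(msize q) {-2}q (leqnn (msize q)) => [|d IH] q qd q0.
  by apply/eqP; rewrite -msize_poly_eq0 -leqn0.
have dq i : mderiv i q = 0.
  apply: IH.
    rewrite msizeE; apply/bigmax_leqP_seq => m.
    rewrite mcoeff_msupp mcoeff_deriv => qm _.
    have : mnm_add m (mnm1 i) \in msupp q.
      by rewrite mcoeff_msupp; apply: contraNneq qm => ->; rewrite mul0rn.
    by move=> /msize_mdeg_lt; rewrite mdegD mdeg1 addn1 => /leq_trans/(_ qd).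
  pose u := \row_i tofrac (comp_mpoly lq (mderiv i q)).
  have : u = 0.
    apply/eqP; rewrite -(mulmx_free_eq0 u freeM); apply/eqP/rowP => j.
    rewrite !mxE; apply: (@etrans _ _ (tofrac (mderiv j (comp_mpoly lq q)))).
      rewrite mderiv_comp raddf_sum /=; apply: eq_bigr => l _.
      by rewrite !mxE rmorphM.
    by rewrite q0 mderiv0 rmorph0.
  by move=> /rowP/(_ i); rewrite !mxE => /eqP; rewrite tofrac_eq0 => /eqP.
have qc : q = mpolyC k (mcoeff mnm0 q).
  apply/mpolyP => m; rewrite mcoeffC; have [->|m0] := eqVneq m mnm0.
    by rewrite mulr1.
  rewrite mulr0; have md : mdeg m = (mdeg m).-1.+1 by rewrite prednK// lt0n mdeg_eq0.
  have [i [m' [-> _]]] := mdeg_succ md.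
  have := mcoeff_deriv i m' q.
  by rewrite dq mcoeff0 => /esym/eqP; rewrite mulrn_eq0 => /eqP.
by move: q0; rewrite qc comp_mpolyC => /eqP; rewrite mpolyC_eq0 => /eqP ->.
Qed.

End Jacobian.

(** * Partial sums of power series and their norms *)

Section Norms.
Context {R : realType} {n : nat}.
Local Notation C := (Cx R).
Local Notation poly := (mpoly n C).
Implicit Types (p q : poly) (c d : multinom n -> C) (r s : C) (z : 'rV[C]_n).

Definition psum c N : poly := \sum_(m : bmultinom n N) c m *: mpolyX C m.

Lemma mcoeff_psum c N m : mcoeff m (psum c N) = if (mdeg m < N)%N then c m else 0.
Proof.
case: ltnP => mN; first exact: mcoeff_mpoly.
rewrite raddf_sum big1 //= => k _; rewrite mcoeffZ mcoeffX.
case: eqP => [km|]; last by rewrite mulr0.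
by have := bmdeg k; rewrite km ltnNge mN.
Qed.

Lemma meval_psum c N z :
  meval (z 0) (psum c N) = \sum_(m : bmultinom n N) c m * \prod_(j < n) z 0 j ^+ m j.
Proof.
by rewrite raddf_sum; apply: eq_bigr => m _ /=; rewrite mevalZ mevalX.
Qed.

(** The sup of [p] on the polydisc of radius [r] is at most [pnorm r p], which
    also is submultiplicative and controls the coefficients: every estimate on
    power series below is an estimate of [pnorm] on partial sums. *)
Definition pnorm r p : C := \sum_(m <- msupp p) `|mcoeff m p| * r ^+ mdeg m.

Lemma pnormE r p N : (msize p <= N)%N ->
  pnorm r p = \sum_(m : bmultinom n N) `|mcoeff m p| * r ^+ mdeg m.
Proof.
move=> pN; pose I : subFinType _ := bmultinom n N.
rewrite /pnorm (big_mksub I) //=; first last.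
- by move=> m /msize_mdeg_lt /leq_trans; apply.
- by rewrite msupp_uniq.
rewrite big_rmcond //= => m /memN_msupp_eq0 ->.
by rewrite normr0 mul0r.
Qed.

Lemma pnorm_psum r c N :
  pnorm r (psum c N) = \sum_(m : bmultinom n N) `|c m| * r ^+ mdeg m.
Proof.
rewrite (@pnormE _ _ N); last first.
  rewrite msizeE; apply/bigmax_leqP_seq => m + _.
  by rewrite mcoeff_msupp mcoeff_psum; case: ifP; rewrite ?eqxx.
by apply: eq_bigr => m _; rewrite mcoeff_psum bmdeg.
Qed.

Lemma pnorm_ge0 r p : 0 <= r -> 0 <= pnorm r p.
Proof. by move=> r0; apply: sumr_ge0 => m _; rewrite mulr_ge0 ?exprn_ge0. Qed.

Lemma pnorm0 r : pnorm r 0 = 0.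
Proof. by rewrite /pnorm msupp0 big_nil. Qed.

Lemma pnormD r p q : 0 <= r -> pnorm r (p + q) <= pnorm r p + pnorm r q.
Proof.
move=> r0; pose N := maxn (msize (p + q)) (maxn (msize p) (msize q)).
rewrite !(@pnormE _ _ N) ?leq_max ?leqnn ?orbT// -big_split /=.
apply: ler_sum => m _; rewrite -mulrDl ler_wpM2r ?exprn_ge0//.
by rewrite mcoeffD ler_normD.
Qed.

Lemma pnorm_sum r (I : Type) (s : seq I) (P : pred I) (F : I -> poly) : 0 <= r ->
  pnorm r (\sum_(i <- s | P i) F i) <= \sum_(i <- s | P i) pnorm r (F i).
Proof.
move=> r0; elim/big_rec2: _ => [|i x y _ xy]; first by rewrite pnorm0.
by rewrite (le_trans (pnormD _ _ r0))// lerD2l.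
Qed.

Lemma pnormN r p : pnorm r (- p) = pnorm r p.
Proof.
rewrite !(@pnormE _ _ (msize p)) ?msizeN//.
by apply: eq_bigr => m _; rewrite mcoeffN normrN.
Qed.

Lemma pnorm_trunc r p N : 0 <= r -> pnorm r (psum (fun m => mcoeff m p) N) <= pnorm r p.
Proof.
move=> r0; have le1 q : (msize q <= msize p)%N -> pnorm r q =
    \sum_(m : bmultinom n (msize p)) `|mcoeff m q| * r ^+ mdeg m.
  by move=> H; exact: pnormE.
rewrite le1 ?[leRHS]le1//.
  apply: ler_sum => m _; rewrite ler_wpM2r ?exprn_ge0// mcoeff_psum.
  by case: ifP => // _; rewrite normr0.
rewrite [msize (psum _ _)]msizeE; apply/bigmax_leqP_seq => m + _.
rewrite mcoeff_msupp mcoeff_psum; case: ifP; rewrite ?eqxx// => _ pm.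
by apply: msize_mdeg_lt; rewrite mcoeff_msupp.
Qed.

Lemma pnorm_psum_le r s c N : 0 <= s -> s <= r -> pnorm s (psum c N) <= pnorm r (psum c N).
Proof.
move=> s0 sr; apply: ler_sum => m _; rewrite ler_wpM2l// lerXn2r// nnegrE//.
exact: le_trans sr.
Qed.

Lemma pnormZX r a m : pnorm r (a *: mpolyX C m) = `|a| * r ^+ mdeg m.
Proof.
have [->|a0] := eqVneq a 0; first by rewrite scale0r pnorm0 normr0 mul0r.
by rewrite /pnorm msuppMCX// big_seq1 mcoeffZ mcoeffX eqxx mulr1.
Qed.

Lemma pnormM r p q : 0 <= r -> pnorm r (p * q) <= pnorm r p * pnorm r q.
Proof.
move=> r0; rewrite mpolyME; apply: le_trans (pnorm_sum _ _ _ r0) _.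
rewrite big_allpairs /= [leRHS]big_distrlr /=; apply: ler_sum => m1 _.
apply: ler_sum => m2 _.
by rewrite pnormZX normrM mdegD exprD mulrACA.
Qed.

Lemma norm_meval_le r p z : (forall j, `|z 0 j| <= r) ->
  `|meval (z 0) p| <= pnorm r p.
Proof.
move=> zr; rewrite mevalE (le_trans (ler_norm_sum _ _ _))//.
apply: ler_sum => m _; rewrite normrM ler_wpM2l// normr_prod.
rewrite mdegE -prodrXr; apply: ler_prod => j _; rewrite normrX.
by rewrite exprn_ge0// lerXn2r ?nnegrE// (le_trans _ (zr j)).
Qed.

(** Schwarz lemma for polynomials that vanish to order [k] at 0. *)
Lemma pnorm_shrink r s p k : 0 <= s -> s <= r -> 0 < r ->
  (forall m, (mdeg m < k)%N -> mcoeff m p = 0) ->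
  pnorm s p <= (s / r) ^+ k * pnorm r p.
Proof.
move=> s0 sr r0 pk; rewrite /pnorm mulr_sumr; apply: ler_sum => m _.
have [mk|km] := ltnP (mdeg m) k; first by rewrite pk// normr0 !mul0r mulr0.
rewrite mulrCA ler_wpM2l// -(subnKC km) !exprD.
rewrite mulrA -exprMn divfK ?gt_eqF// ler_wpM2l ?exprn_ge0//.
by rewrite lerXn2r ?nnegrE// (le_trans s0 sr).
Qed.

End Norms.

Section Expansions.
Context {R : realType} {n : nat}.
Local Notation C := (Cx R).
Local Notation poly := (mpoly n C).
Implicit Types (p q : poly) (c d : multinom n -> C) (r s : C) (a z : 'rV[C]_n).
Implicit Types (f g : 'rV[C]_n -> C).

Definition expands r (M : C) f a c : Prop :=
  [/\ 0 < r, forall N, pnorm r (psum c N) <= M &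
      forall z, (forall j, `|z 0 j| < r) ->
        (fun N => meval (z 0) (psum c N)) @ \oo --> f (a + z)].

Lemma has_expansionP f a c :
  has_expansion f a c <-> exists r M, expands r M f a c.
Proof.
split=> [[r r0 [[M cM] cf]]|[r [M [r0 cM cf]]]].
  exists r, M; split=> // [N|z zr]; first by rewrite pnorm_psum.
  by under eq_cvg do rewrite meval_psum; apply: cf.
exists r => //; split; first by exists M => N; rewrite -pnorm_psum.
by move=> z zr; under eq_cvg do rewrite -meval_psum; apply: cf.
Qed.

Lemma expands_M r M f a c : expands r M f a c -> 0 <= M.
Proof.
by move=> [r0 cM _]; rewrite (le_trans _ (cM 0%N))// pnorm_ge0// ltW.
Qed.

Lemma expands_shrink r s M f a c :
  0 < s -> s <= r -> expands r M f a c -> expands s M f a c.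
Proof.
move=> s0 sr [r0 cM cf]; split=> // [N|z zs]; last first.
  by apply: cf => j; rewrite (lt_le_trans (zs j)).
by rewrite (le_trans _ (cM N))// pnorm_psum_le// ltW.
Qed.

Lemma exists_common_radius r s : 0 < r -> 0 < s ->
  exists t : C, [/\ 0 < t, t <= r & t <= s].
Proof.
move=> r0 s0; have [rs|sr] := real_leP (gtr0_real r0) (gtr0_real s0).
  by exists r.
by exists s; rewrite ltW.
Qed.

(** The order of [C] is partial, hence the detour by [real_leNgt]. *)
Lemma cvg_norm_le (u : nat -> C) (l v B : C) :
  u @ \oo --> l -> (\forall N \near \oo, `|u N - v| <= B) -> `|l - v| <= B.
Proof.
move=> ul uB; have B0 : 0 <= B.
  by near \oo => N; apply: (le_trans (normr_ge0 (u N - v))); near: N.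
rewrite real_leNgt ?ger0_real//; apply/negP => Bl.
move/cvgrPdist_lt: ul => /(_ (`|l - v| - B)); rewrite subr_gt0 => /(_ Bl) ul.
near \oo => N.
have : `|l - v| < `|l - v|.
  rewrite {1}(_ : l - v = (l - u N) + (u N - v)); last by rewrite addrA subrK.
  apply: le_lt_trans (ler_normD _ _) _.
  rewrite -[ltRHS](subrK B); apply: ltr_leD; near: N; first exact: ul.
  exact: uB.
by rewrite ltxx.
Unshelve. all: by end_near. Qed.

(** The archimedean property of [R], transported to [C] through real parts. *)
Lemma cvg_geo0 (K : C) : (fun N => K * (2^-1) ^+ N) @ \oo --> (0 : C).
Proof.
apply/cvgrPdist_lt => e e0.
have Ke : 0 <= `|K| / e by rewrite divr_ge0// ltW.
have [x Kx] : exists x : R, `|K| / e = x%:C%C.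
  exists (complex.Re (`|K| / e)).
  by move: Ke; rewrite lecE /= => /andP[/eqP Ke _]; case: (_ / _) Ke => a b /= ->.
have x0 : 0 <= x by move: Ke; rewrite Kx lecR.
near=> N.
rewrite sub0r normrN normrM normrX (ger0_norm (_ : 0 <= 2^-1)) ?invr_ge0//.
rewrite exprVn ltr_pdivrMr ?exprn_gt0// mulrC -ltr_pdivrMr// Kx.
apply: (@lt_trans _ _ (N%:R : C)); last first.
  by rewrite -natrX ltr_nat ltn_expl.
have -> : N%:R = (N%:R : R)%:C%C :> C by rewrite rmorph_nat.
rewrite ltcR; near: N; exact: nbhs_infty_gtr.
Unshelve. all: by end_near. Qed.

Lemma cvg_geo_bound (u v : nat -> C) (K l : C) :
  (forall N, `|u N - v N| <= K * 2^-1 ^+ N) -> u @ \oo --> l -> v @ \oo --> l.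
Proof.
move=> uv ul; suff : (fun N => u N - v N) @ \oo --> (0 : C).
  move=> /(cvgB ul); rewrite subr0; apply: cvg_trans; apply: near_eq_cvg.
  by near=> N => /=; rewrite opprB addrC subrK.
apply/cvgrPdist_lt => e e0; have /cvgrPdist_lt/(_ e e0) := cvg_geo0 K.
apply: filterS => N; rewrite !sub0r !normrN; apply: le_lt_trans.
rewrite (le_trans (uv N))// real_ler_norm// ger0_real//.
by rewrite (le_trans _ (uv N)).
Unshelve. all: by end_near. Qed.

Lemma small_eq0 (x K s : C) : 0 <= x -> 0 <= K -> 0 < s ->
  (forall h, 0 < h -> h <= s -> x <= h * K) -> x = 0.
Proof.
move=> x0 K0 s0 bnd; apply/eqP; rewrite eq_le x0 andbT.
rewrite real_leNgt ?ger0_real//; apply/negP => D0.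
have pos : 0 < s^-1 + K / x by rewrite ltr_pwDl ?invr_gt0// divr_ge0.
have hs : (s^-1 + K / x)^-1 <= s.
  by rewrite invf_ple ?posrE// lerDl divr_ge0.
have := bnd (s^-1 + K / x)^-1; rewrite invr_gt0 => /(_ pos hs).
rewrite ler_pdivlMl// mulrDl divfK ?gt_eqF// gerDr.
by rewrite lt_geF// mulr_gt0 ?invr_gt0.
Qed.

Lemma near0_small (r K e : C) : 0 < r -> 0 <= K -> 0 < e ->
  \forall h \near (0 : C)^', [/\ h != 0, `|h| <= r & `|h| * K <= e].
Proof.
move=> r0 K0 e0.
have pos : 0 < r^-1 + K / e by rewrite ltr_pwDl ?invr_gt0// divr_ge0// ltW.
have pos' : 0 < (r^-1 + K / e)^-1 by rewrite invr_gt0.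
near=> h.
have hr : `|h| < (r^-1 + K / e)^-1 by near: h; exact: dnbhs0_lt.
have {}hr : `|h| * (r^-1 + K / e) < 1 by rewrite -ltr_pdivlMr// mul1r.
split; first by near: h; exact: nbhs_dnbhs_neq.
  rewrite -[leRHS]mul1r -ler_pdivrMr// ltW//; apply: le_lt_trans hr.
  by rewrite ler_wpM2l// lerDl divr_ge0// ltW.
rewrite -[leRHS]mul1r -ler_pdivrMr// -mulrA ltW//; apply: le_lt_trans hr.
by rewrite ler_wpM2l// lerDr invr_ge0 ltW.
Unshelve. all: by end_near. Qed.

Lemma exists_polydisc z : exists2 s : C, 0 < s & forall j, `|z 0 j| <= s.
Proof.
exists (1 + \sum_j `|z 0 j|); first by rewrite ltr_pwDl// sumr_ge0.
by move=> j; rewrite (bigD1 j)//= addrCA lerDl addr_ge0// sumr_ge0.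
Qed.

End Expansions.

(** The remainder has the coefficients 'C(k, j), j >= 2, whose sum is
    [2 ^ k - k - 1]; the induction runs on that exact sum. *)
Lemma pow_taylor2 (F : numFieldType) (x h s : F) k : 0 < s -> `|x| <= s -> `|h| <= s ->
  `|(x + h) ^+ k - x ^+ k - h * (x ^+ k.-1 *+ k)|
    <= (`|h| / s) ^+ 2 * (s ^+ k * (2 ^+ k - k.+1%:R)).
Proof.
move=> s0 xs hs; elim: k => [|k IH].
  by rewrite !expr0 mulr0n mulr0 subr0 !subrr normr0 !mulr0.
have -> : (x + h) ^+ k.+1 - x ^+ k.+1 - h * (x ^+ k.+1.-1 *+ k.+1)
  = (x + h) * ((x + h) ^+ k - x ^+ k - h * (x ^+ k.-1 *+ k))
    + h ^+ 2 * (x ^+ k.-1 *+ k).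
  case: k {IH} => [|k]; first by rewrite !expr0 !expr1 !mulr0n mulr1n; ring.
  rewrite /= (mulrS _ k.+1) -(mulr_natr (x ^+ k.+1)) -(mulr_natr (x ^+ k)).
  by rewrite (exprS (x + h) k.+1) (exprS x k.+1) (exprS x k); ring.
apply: le_trans (ler_normD _ _) _; rewrite normrM [X in _ + X]normrM (normrX 2 h).
have xk : `|x ^+ k.-1 *+ k| <= s ^+ k.-1 *+ k.
  by rewrite normrMn lerMn2r normrX lerXn2r ?nnegrE ?orbT ?(ltW s0).
apply: (@le_trans _ _ ((s + s) * ((`|h| / s) ^+ 2 * (s ^+ k * (2 ^+ k - k.+1%:R)))
   + `|h| ^+ 2 * (s ^+ k.-1 *+ k))).
  apply: lerD; last by rewrite ler_wpM2l ?exprn_ge0.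
  by rewrite ler_pM// (le_trans (ler_normD _ _))// lerD.
rewrite le_eqVlt; apply/orP; left; apply/eqP.
case: k {IH xk} => [|k].
  by rewrite !expr0 expr1 mulr0n; field; rewrite gt_eqF.
rewrite /= -(mulr_natr (s ^+ k)) (mulrS 1 k.+2) (exprS 2 k.+1) (exprS s k.+1) (exprS s k).
by rewrite (mulrS 1 k.+1); field; rewrite gt_eqF.
Qed.

Section PolyTaylor.
Context {R : realType} {n : nat}.
Local Notation C := (Cx R).
Local Notation poly := (mpoly n C).
Implicit Types (p q : poly) (c d : multinom n -> C) (r s h : C) (a z : 'rV[C]_n).

(** Uniform in [p] for a given [pnorm]: this is what allows differentiating a
    power series term by term. *)
Lemma poly_taylor2 p i z h s : 0 < s -> (forall j, `|z 0 j| <= s) -> `|h| <= s ->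
  `|meval ((z + h *: delta_mx 0 i) 0) p - meval (z 0) p
      - h * meval (z 0) (mderiv i p)|
    <= (`|h| / s) ^+ 2 * pnorm (2 * s) p.
Proof.
move=> s0 zs hs; rewrite {1 2 3}[p]mpolyE [mderiv i _]raddf_sum /=.
rewrite ![meval _ (\sum_(_ <- _) _)]raddf_sum /= mulr_sumr -!sumrB.
apply: le_trans (ler_norm_sum _ _ _) _.
rewrite /pnorm mulr_sumr; apply: ler_sum => m _.
set b := mcoeff m p; rewrite mderivZ !mevalZ mderivX mevalZ !mevalX.
rewrite (mulrCA h) -!mulrBr normrM [leRHS]mulrCA ler_wpM2l//.
have splitE (w : 'rV[C]_n) (k : multinom n) : \prod_(j < n) w 0 j ^+ k j =
    w 0 i ^+ k i * \prod_(j < n | j != i) w 0 j ^+ k j by rewrite (bigD1 i).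
rewrite !splitE; set P := \prod_(j < n | j != i) z 0 j ^+ m j.
have -> : \prod_(j < n | j != i) (z + h *: delta_mx 0 i) 0 j ^+ m j = P.
  by apply: eq_bigr => j ji; rewrite !mxE eqxx (negPf ji) /= mulr0 addr0.
have -> : \prod_(j < n | j != i) z 0 j ^+ (mnm_sub m (mnm1 i)) j = P.
  by apply: eq_bigr => j ji; rewrite mnmBE mnm1E eq_sym (negPf ji) subn0.
rewrite !mxE !eqxx /= mulr1 mnmBE mnm1E eqxx subn1.
have -> : (z 0 i + h) ^+ m i * P - z 0 i ^+ m i * P
     - h * ((m i)%:R * (z 0 i ^+ (m i).-1 * P)) =
   P * ((z 0 i + h) ^+ m i - z 0 i ^+ m i - h * (z 0 i ^+ (m i).-1 *+ m i)).
  rewrite -(mulr_natr (z 0 i ^+ (m i).-1)) !mulrBr ![P * (_ ^+ _)]mulrC; congr (_ - _).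
  by rewrite (mulrC P) -!mulrA [X in h * X = _]mulrCA.
rewrite normrM.
have P1 : `|P| <= \prod_(j < n | j != i) (2 * s) ^+ m j.
  rewrite normr_prod; apply: ler_prod => j _; rewrite normrX exprn_ge0//=.
  rewrite lerXn2r ?nnegrE ?mulr_ge0 ?(ltW s0)// (le_trans (zs j))//.
  by rewrite ler_peMl ?(ltW s0)// ler1n.
have -> : (2 * s) ^+ mdeg m = \prod_(j < n | j != i) (2 * s) ^+ m j * (2 * s) ^+ m i.
  by rewrite mdegE -prodrXr (bigD1 i)//= mulrC.
rewrite mulrCA; apply: ler_pM => //.
apply: le_trans (pow_taylor2 _ s0 (zs i) hs) _.
rewrite ler_wpM2l ?exprn_ge0 ?divr_ge0 ?(ltW s0)// exprMn [leRHS]mulrC.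
by rewrite ler_wpM2l ?exprn_ge0 ?(ltW s0)// gerBl.
Qed.

Lemma meval_mderiv_eq0 p (i : 'I_n) :
  (forall z, meval (z 0) p = 0) -> forall z, meval (z 0) (mderiv i p) = 0.
Proof.
move=> p0 z; apply/eqP; rewrite -normr_eq0; apply/eqP.
set D := meval _ _; have [s s0 zs] := exists_polydisc z.
pose K := pnorm (2 * s) p / s ^+ 2.
have bnd (h : C) : 0 < h -> h <= s -> `|D| <= h * K.
  move=> h0 hs.
  have := @poly_taylor2 p i z h s s0 zs.
  rewrite !p0 subr0 sub0r normrN normrM gtr0_norm// => /(_ hs).
  move=> H; rewrite /D -(ler_pM2l h0); apply: (le_trans H).
  by rewrite /K expr_div_n expr2 !mulrA le_eqVlt mulrAC eqxx.
apply: (@small_eq0 R `|D| K s (normr_ge0 _) _ s0 bnd).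
by rewrite divr_ge0 ?exprn_ge0 ?pnorm_ge0 ?mulr_ge0 ?(ltW s0).
Qed.

Lemma meval_at0 p : meval ((0 : 'rV[C]_n) 0) p = mcoeff mnm0 p.
Proof.
rewrite mevalE {3}[p]mpolyE raddf_sum /=; apply: eq_bigr => m _.
rewrite mcoeffZ mcoeffX; congr (_ * _); case: eqVneq => [->|].
  by rewrite big1// => i _; rewrite mnm0E expr0.
rewrite -mdeg_eq0 mdegE sum_nat_eq0 negb_forall => /existsP[i /= mi].
by rewrite (bigD1 i)//= mxE expr0n (negPf mi) mul0r.
Qed.

(** By induction on the degree of [m]: the coefficient of [m] in [p] is, up to a
    non-zero integer, a coefficient of lower degree of a derivative of [p]. *)
Lemma meval_eq0 p : (forall z, meval (z 0) p = 0) -> p = 0.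
Proof.
move=> p0; apply/mpolyP => m; rewrite mcoeff0.
elim: {m}(mdeg m) {-2}m (erefl (mdeg m)) p p0 => [|k IH] m mk p p0.
  have /eqP -> : m == mnm0 by rewrite -mdeg_eq0 mk.
  by rewrite -meval_at0 p0.
have [i [m' [-> m'k]]] := mdeg_succ mk.
have := IH _ m'k (mderiv i p) (meval_mderiv_eq0 i p0).
by rewrite mcoeff_deriv => /eqP; rewrite mulrn_eq0 => /eqP.
Qed.

End PolyTaylor.

(** * Order of vanishing at a point *)

Section OrdGe.
Context {R : realType} {n : nat}.
Local Notation C := (Cx R).
Local Notation poly := (mpoly n C).
Implicit Types (p q : poly) (c d : multinom n -> C) (r s h : C) (a z : 'rV[C]_n).
Implicit Types (f g : 'rV[C]_n -> C).

(** [f (a + z)] is a big O of the [k]-th power of the sup norm of [z]. The bound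
    is stated through a radius [s] so that it makes sense in dimension 0 too. *)
Definition ord_ge f a k : Prop := exists r K : C, [/\ 0 < r, 0 <= K &
  forall s z, 0 <= s -> s < r -> (forall j, `|z 0 j| <= s) ->
    `|f (a + z)| <= K * s ^+ k].

Lemma ord_ge_le f a k l : (l <= k)%N -> ord_ge f a k -> ord_ge f a l.
Proof.
move=> lk [r [K [r0 K0 H]]]; exists r, (K * r ^+ (k - l)); split => //.
  by rewrite mulr_ge0 ?exprn_ge0 ?(ltW r0).
move=> s z s0 sr zs; apply: le_trans (H s z s0 sr zs) _.
rewrite -{1}(subnK lk) exprD mulrA ler_wpM2r ?exprn_ge0// ler_wpM2l//.
by rewrite lerXn2r ?nnegrE ?(ltW r0)// ltW.
Qed.

Lemma ord_ge_eqfun f g a k : f =1 g -> ord_ge f a k -> ord_ge g a k.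
Proof.
move=> fg [r [K [r0 K0 H]]].
by exists r, K; split => // s z *; rewrite -fg; apply: H.
Qed.

Lemma ord_ge0 a k : ord_ge (fun=> 0) a k.
Proof. by exists 1, 0; split=> // s z *; rewrite normr0 mul0r. Qed.

Lemma ord_ge_cst a b : ord_ge (fun=> b) a 0.
Proof. by exists 1, `|b|; split=> // s z *; rewrite expr0 mulr1. Qed.

Lemma ord_geD f g a k : ord_ge f a k -> ord_ge g a k -> ord_ge (fun x => f x + g x) a k.
Proof.
move=> [r [K [r0 K0 H]]] [r' [K' [r0' K0' H']]].
have [t [t0 tr tr']] := exists_common_radius r0 r0'.
exists t, (K + K'); split=> // [|s z s0 st zs]; first exact: addr_ge0.
rewrite (le_trans (ler_normD _ _))// mulrDl lerD ?H ?H'//.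
  exact: lt_le_trans tr.
exact: lt_le_trans tr'.
Qed.

Lemma ord_geM f g a k l :
  ord_ge f a k -> ord_ge g a l -> ord_ge (fun x => f x * g x) a (k + l).
Proof.
move=> [r [K [r0 K0 H]]] [r' [K' [r0' K0' H']]].
have [t [t0 tr tr']] := exists_common_radius r0 r0'.
exists t, (K * K'); split=> // [|s z s0 st zs]; first exact: mulr_ge0.
rewrite normrM exprD mulrACA ler_pM ?H ?H'//.
  exact: lt_le_trans tr.
exact: lt_le_trans tr'.
Qed.

Lemma ord_geZ b f a k : ord_ge f a k -> ord_ge (fun x => b * f x) a k.
Proof. by move=> Hf; apply: (ord_geM (ord_ge_cst a b) Hf). Qed.

Lemma ord_geN f a k : ord_ge f a k -> ord_ge (fun x => - f x) a k.
Proof. by move=> Hf; apply: ord_ge_eqfun (ord_geZ (-1) Hf) => x; rewrite mulN1r. Qed.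

Lemma ord_geB f g a k : ord_ge f a k -> ord_ge g a k -> ord_ge (fun x => f x - g x) a k.
Proof. by move=> Hf Hg; apply: ord_geD Hf (ord_geN Hg). Qed.

Lemma ord_ge_sum (I : Type) (s : seq I) (P : pred I) (F : I -> 'rV[C]_n -> C) a k :
  (forall i, P i -> ord_ge (F i) a k) -> ord_ge (fun x => \sum_(i <- s | P i) F i x) a k.
Proof.
move=> H; elim: s => [|i s IH].
  by apply: ord_ge_eqfun (ord_ge0 a k) => x; rewrite big_nil.
case Pi : (P i); last by apply: ord_ge_eqfun IH => x; rewrite big_cons Pi.
by apply: ord_ge_eqfun (ord_geD (H _ Pi) IH) => x; rewrite big_cons Pi.
Qed.

Lemma ord_ge_prod (I : Type) (s : seq I) (F : I -> 'rV[C]_n -> C) (e : I -> nat) a :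
  (forall i, ord_ge (F i) a (e i)) ->
  ord_ge (fun x => \prod_(i <- s) F i x) a (\sum_(i <- s) e i)%N.
Proof.
move=> H; elim: s => [|i s IH].
  by rewrite big_nil; apply: ord_ge_eqfun (ord_ge_cst a 1) => x; rewrite big_nil.
by rewrite big_cons; apply: ord_ge_eqfun (ord_geM (H i) IH) => x; rewrite big_cons.
Qed.

Lemma ord_ge_poly p a k : (forall m, (mdeg m < k)%N -> mcoeff m p = 0) ->
  ord_ge (fun x => meval ((x - a) 0) p) a k.
Proof.
move=> pk; exists 1, (pnorm 1 p); split=> [//||s z s0 s1 zs].
  exact: pnorm_ge0.
rewrite addrC addKr (le_trans (norm_meval_le _ zs))//.
rewrite (le_trans (@pnorm_shrink _ _ 1 s p k s0 (ltW s1) ltr01 pk))//.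
by rewrite divr1 mulrC.
Qed.

Lemma meval_homogZ p k (t : C) z : (forall m, mdeg m != k -> mcoeff m p = 0) ->
  meval ((t *: z) 0) p = t ^+ k * meval (z 0) p.
Proof.
move=> pk; rewrite !mevalE mulr_sumr; apply: eq_bigr => m _.
have [<-|mk] := eqVneq (mdeg m) k; last by rewrite pk// !mul0r mulr0.
rewrite mulrCA mdegE -prodrXr -big_split /=; congr (_ * _); apply: eq_bigr => j _.
by rewrite mxE exprMn.
Qed.

(** Along a ray, [p (t z) = t ^ k p z] while the hypothesis bounds it by
    [t ^ (k + 1)]. *)
Lemma homog_ord_ge_eq0 p a k : (forall m, mdeg m != k -> mcoeff m p = 0) ->
  ord_ge (fun x => meval ((x - a) 0) p) a k.+1 -> p = 0.
Proof.
move=> pk [r [K [r0 K0 H]]]; apply: meval_eq0 => z.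
have [s s0 zs] := exists_polydisc z.
apply/eqP; rewrite -normr_eq0; apply/eqP.
apply: (@small_eq0 R _ (K * s ^+ k.+1) (r / (2 * s)) (normr_ge0 _)).
- by rewrite mulr_ge0 ?exprn_ge0 ?(ltW s0).
- by rewrite divr_gt0// mulr_gt0.
move=> h h0 hs; rewrite -(ler_pM2l (exprn_gt0 k h0)).
have := H (h * s) (h *: z); rewrite addrC addKr (meval_homogZ h z pk).
rewrite normrM normrX (gtr0_norm h0) => H'; apply: (le_trans (H' _ _ _)).
- by rewrite mulr_ge0 ?(ltW s0) ?(ltW h0).
- rewrite -ltr_pdivlMr//; apply: le_lt_trans hs _.
  by rewrite ltr_pM2l// ltf_pV2 ?posrE ?mulr_gt0// ltr_pMl// ltr1n.
- by move=> j; rewrite mxE normrM (gtr0_norm h0) ler_wpM2l// ltW.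
by rewrite exprMn exprSr !mulrA ler_wpM2r ?exprn_ge0 ?(ltW s0)// -mulrA mulrC.
Qed.

(** Peeling off the homogeneous components of [p] in increasing degree. *)
Lemma ord_ge_poly_coef p a k : ord_ge (fun x => meval ((x - a) 0) p) a k ->
  forall m, (mdeg m < k)%N -> mcoeff m p = 0.
Proof.
elim: k => [//|k IH] H m; rewrite ltnS leq_eqVlt => /orP[/eqP mk|]; last first.
  exact: (IH (ord_ge_le (leqnSn k) H)).
pose pk := psum (fun m => if mdeg m == k then mcoeff m p else 0) k.+1.
have pkE m' : mcoeff m' pk = if mdeg m' == k then mcoeff m' p else 0.
  by rewrite mcoeff_psum; case: eqVneq => [->|]; rewrite ?ltnSn ?if_same.
have : mcoeff m pk = 0.
  suff -> : pk = 0 by rewrite mcoeff0.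
  apply: (@homog_ord_ge_eq0 pk a k).
    by move=> m' m'k; rewrite pkE (negPf m'k).
  have : ord_ge (fun x => meval ((x - a) 0) (p - pk)) a k.+1.
    apply: ord_ge_poly => m'; rewrite ltnS leq_eqVlt mcoeffB pkE.
    case: eqP => [|_ /= m'k]; first by rewrite subrr.
    by rewrite (IH (ord_ge_le (leqnSn k) H))// subrr.
  move=> H'; apply: ord_ge_eqfun (ord_geB H H') => x.
  by rewrite mevalB opprB addrC subrK.
by rewrite pkE mk eqxx.
Qed.

(** Taylor's formula at the order [k]. *)
Lemma has_expansion_ord_ge f a c k : has_expansion f a c ->
  ord_ge (fun x => f x - meval ((x - a) 0) (psum c k)) a k.
Proof.
move=> /has_expansionP[r [M [r0 cM cf]]].
have M0 : 0 <= M by rewrite (le_trans _ (cM 0%N))// pnorm_ge0// ltW.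
exists r, (r ^- k * (M + M)); split=> [//||s z s0 sr zs].
  by rewrite mulr_ge0 ?addr_ge0// invr_ge0 exprn_ge0// ltW.
rewrite [a + z - a]addrC addKr; apply: (cvg_norm_le (cf z _)).
  by move=> j; apply: le_lt_trans sr.
near=> N; rewrite -mevalB (le_trans (norm_meval_le _ zs))//.
have kN : (k <= N)%N by near: N; exact: nbhs_infty_ge.
apply: (le_trans (@pnorm_shrink _ _ r s _ k s0 (ltW sr) r0 _)).
  by move=> m mk; rewrite mcoeffB !mcoeff_psum mk (leq_trans mk kN) subrr.
rewrite mulrAC expr_div_n [X in _ <= X * _]mulrC ler_wpM2l//.
  by rewrite divr_ge0 ?exprn_ge0// ltW.
by rewrite (le_trans (pnormD _ _ (ltW r0)))// pnormN lerD.
Unshelve. all: by end_near. Qed.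

Lemma has_expansion_ord_geP f a c k : has_expansion f a c ->
  ord_ge f a k <-> (forall m, (mdeg m < k)%N -> c m = 0).
Proof.
move=> fc; have H := has_expansion_ord_ge k fc; split=> [fk m mk|ck].
  rewrite -[LHS](_ : mcoeff m (psum c k) = _); last by rewrite mcoeff_psum mk.
  apply: (@ord_ge_poly_coef _ a k) => //.
  by apply: ord_ge_eqfun (ord_geB fk H) => x; rewrite opprB addrC subrK.
apply: ord_ge_eqfun H => x; rewrite [psum c k](_ : _ = 0) ?meval0 ?subr0//.
by apply/mpolyP => m; rewrite mcoeff_psum mcoeff0; case: ifP => // /ck.
Qed.

Lemma has_expansion_uniq f a c d : has_expansion f a c -> has_expansion f a d -> c = d.
Proof.
move=> fc fd; apply/funext => m; apply/eqP; rewrite -subr_eq0; apply/eqP.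
have H := ord_geB (has_expansion_ord_ge (mdeg m).+1 fd)
  (has_expansion_ord_ge (mdeg m).+1 fc).
have H' : ord_ge (fun x => meval ((x - a) 0)
    (psum c (mdeg m).+1 - psum d (mdeg m).+1)) a (mdeg m).+1.
  by apply: ord_ge_eqfun H => x; rewrite mevalB opprB addrC addrA subrK.
by have := ord_ge_poly_coef H' (ltnSn _); rewrite mcoeffB !mcoeff_psum ltnSn.
Qed.

Lemma taylorE f a c : has_expansion f a c -> taylor f a = c.
Proof.
move=> fc; rewrite /taylor; case: xgetP => [d -> /= fd|/(_ c)//].
exact: has_expansion_uniq fd fc.
Qed.

Lemma holomorphic_taylor f a : holomorphic_at f a -> has_expansion f a (taylor f a).
Proof. by move=> [c fc]; rewrite (taylorE fc). Qed.

End OrdGe.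

(** * Derivatives, sums and products of power series *)

Section Germs.
Context {R : realType} {n : nat}.
Local Notation C := (Cx R).
Local Notation poly := (mpoly n C).
Implicit Types (p q : poly) (c d : multinom n -> C) (r s h : C) (a z : 'rV[C]_n).
Implicit Types (f g : 'rV[C]_n -> C).

Lemma near_polydisc (P : 'rV[C]_n -> Prop) a :
  (\forall x \near a, P x) <->
  exists2 r : C, 0 < r & forall z, (forall j, `|z 0 j| < r) -> P (a + z).
Proof.
split=> [/nbhs_ballP[r /= r0 H]|[r r0 H]].
  exists r => // z zr; apply: H; split=> // i j; rewrite ord1 -ball_normE /= mxE.
  by rewrite opprD addNKr normrN.
apply/nbhs_ballP; exists r => //= x ax; rewrite -(subrK a x) addrC; apply: H => j.
by have := ax.2 0 j; rewrite -ball_normE /= !mxE distrC.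
Qed.

Lemma ord_ge_near f g a k : (\near a, f a = g a) -> ord_ge f a k -> ord_ge g a k.
Proof.
move=> /near_polydisc[s s0 fg] [r [K [r0 K0 H]]].
have [t [t0 tr ts]] := exists_common_radius r0 s0.
exists t, K; split=> // u z u0 ut zu; rewrite -fg.
  by apply: H => //; exact: lt_le_trans tr.
by move=> j; apply: le_lt_trans (zu j) (lt_le_trans ut ts).
Qed.

Lemma psum1 c : psum c 1 = mpolyC n (c mnm0).
Proof.
apply/mpolyP => m; rewrite mcoeff_psum mcoeffC ltnS leqn0 mdeg_eq0.
by case: eqVneq => [->|]; rewrite ?mulr1 ?mulr0.
Qed.

Lemma psum2E c z : meval (z 0) (psum c 2) = c mnm0 + \sum_j c (mnm1 j) * z 0 j.
Proof.
rewrite [psum c 2](_ : _ = mpolyC n (c mnm0) + \sum_j c (mnm1 j) *: mpolyX C (mnm1 j)).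
  rewrite mevalD mevalC raddf_sum /=; congr (_ + _).
  by apply: eq_bigr => j _; rewrite mevalZ mevalXU.
apply/mpolyP => m; rewrite mcoeff_psum mcoeffD mcoeffC raddf_sum /=.
have [->|m0] := eqVneq m mnm0.
  rewrite mdeg0 mulr1 big1 ?addr0// => j _.
  by rewrite mcoeffZ mcoeffX mnm1_eq0 mulr0.
rewrite mulr0 add0r; case: ifP => md.
  have /mdeg1P[i /eqP ->] : mdeg m == 1%N.
    by rewrite eqn_leq -ltnS md /= lt0n mdeg_eq0.
  rewrite (bigD1 i)//= mcoeffZ mcoeffX eqxx mulr1 big1 ?addr0// => j ji.
  by rewrite mcoeffZ mcoeffX eq_mnm1 (negPf ji) mulr0.
rewrite big1// => j _; rewrite mcoeffZ mcoeffX; case: eqP => [jm|]; last by rewrite mulr0.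
by rewrite -jm mdeg1 in md.
Qed.

Lemma has_expansion_at f a c : has_expansion f a c -> f a = c mnm0.
Proof.
move=> /(has_expansion_ord_ge 1)[r [K [r0 _]]] /(_ 0 0 (lexx _) r0).
rewrite expr1 mulr0 addr0 subrr meval_at0 mcoeff_psum mdeg0 /=.
move=> H; apply/eqP; rewrite -subr_eq0 -normr_le0; apply: H => j.
by rewrite mxE normr0.
Qed.

Lemma has_expansion_linear f a c : has_expansion f a c ->
  ord_ge (fun x => f x - f a - \sum_j c (mnm1 j) * (x - a) 0 j) a 2.
Proof.
move=> fc; apply: ord_ge_eqfun (has_expansion_ord_ge 2 fc) => x.
by rewrite psum2E (has_expansion_at fc) opprD addrA.
Qed.

Lemma ord_ge_linear_derive f a (L : 'I_n -> C) i :
  ord_ge (fun x => f x - f a - \sum_j L j * (x - a) 0 j) a 2 ->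
  (fun h : C => h^-1 *: ((f \o shift a) (h *: delta_mx 0 i) - f a)) @ 0^' --> L i.
Proof.
move=> [r [K [r0 K0 H]]]; apply/cvgrPdist_le => e e0.
have r2 : 0 < r / 2 by rewrite divr_gt0.
near=> h.
have [h0 hr hK] : [/\ h != 0, `|h| <= r / 2 & `|h| * K <= e].
  by near: h; exact: near0_small.
have := H `|h| (h *: delta_mx 0 i) (normr_ge0 _).
rewrite [a + _]addrC addrK (bigD1 i)//= big1 ?addr0.
  rewrite !mxE !eqxx mulr1 => Hh.
  have -> : L i - h^-1 *: ((f \o shift a) (h *: delta_mx 0 i) - f a)
    = - (h^-1 * (f (h *: delta_mx 0 i + a) - f a - L i * h)).
    by rewrite mulrBr mulrCA mulVf// mulr1 opprB.
  rewrite normrN normrM normfV ler_pdivrMl ?normr_gt0//.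
  apply: (le_trans (Hh _ _)).
  - by apply: le_lt_trans hr _; rewrite ltr_pdivrMr// ltr_pMr// ltr1n.
  - move=> j; rewrite !mxE normrM ler_piMr//.
    by case: (_ && _); rewrite ?normr1 ?normr0.
  by rewrite expr2 mulrCA ler_wpM2l// mulrC.
by move=> j ji; rewrite !mxE (negPf ji) andbF !mulr0.
Unshelve. all: by end_near. Qed.

Lemma ord_ge_linear_partial f a (L : 'I_n -> C) i :
  ord_ge (fun x => f x - f a - \sum_j L j * (x - a) 0 j) a 2 -> partial i f a = L i.
Proof.
by move=> /(@ord_ge_linear_derive _ _ _ i); apply: cvg_lim; exact: norm_hausdorff.
Qed.

Lemma has_expansion_partial_at f a c i : has_expansion f a c -> partial i f a = c (mnm1 i).
Proof.
by move=> /has_expansion_linear/(@ord_ge_linear_partial _ _ _ i).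
Qed.

Lemma has_expansion_cst b a :
  has_expansion (fun=> b) a (fun m => if m == mnm0 then b else 0).
Proof.
have E N : psum (fun m => if m == mnm0 then b else 0) N.+1 = mpolyC n b :> poly.
  apply/mpolyP => m; rewrite mcoeff_psum mcoeffC.
  by case: eqVneq => [->|]; rewrite ?mdeg0 ?mulr1// if_same mulr0.
apply/has_expansionP; exists 1, `|b|; split=> // [[|N]|z _].
- rewrite pnorm_psum big1// => m _; case: eqP => [mE|_].
    by have := bmdeg m; rewrite mE mdeg0.
  by rewrite normr0 mul0r.
- by rewrite E -alg_mpolyC -mpolyX0 pnormZX expr1n mulr1.
by apply: cvg_near_cst; exists 1%N => // -[//|N] _; rewrite E mevalC.
Qed.

Lemma has_expansionD f g a c d : has_expansion f a c -> has_expansion g a d ->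
  has_expansion (fun x => f x + g x) a (fun m => c m + d m).
Proof.
move=> /has_expansionP[r [M H]] /has_expansionP[s [M' H']].
have r0 : 0 < r by case: H.
have s0 : 0 < s by case: H'.
have [t [t0 tr ts]] := exists_common_radius r0 s0.
have [_ cM cf] := expands_shrink t0 tr H.
have [_ dM dg] := expands_shrink t0 ts H'.
have E N : psum (fun m => c m + d m) N = psum c N + psum d N.
  by rewrite /psum -big_split; apply: eq_bigr => m _; rewrite scalerDl.
apply/has_expansionP; exists t, (M + M'); split=> [//|N|z zt].
  by rewrite E (le_trans (pnormD _ _ (ltW t0)))// lerD.
by under eq_cvg do rewrite E mevalD; apply: cvgD; [exact: cf|exact: dg].
Qed.

(** The partial sum [psum e N] of the Cauchy product is the truncation of
    [P N := psum c N * psum d N]. The rest of [P N] has only monomials of degree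
    at least [N], so on the half polydisc it is bounded by a geometric sequence. *)
Lemma has_expansionM f g a c d : has_expansion f a c -> has_expansion g a d ->
  holomorphic_at (fun x => f x * g x) a.
Proof.
move=> /has_expansionP[r [M H]] /has_expansionP[s [M' H']].
have r0 : 0 < r by case: H.
have s0 : 0 < s by case: H'.
have [t [t0 tr ts]] := exists_common_radius r0 s0.
have [_ cM cf] := expands_shrink t0 tr H.
have [_ dM dg] := expands_shrink t0 ts H'.
pose P N := psum c N * psum d N : poly.
pose e m := mcoeff m (P (mdeg m).+1).
have eP N : psum e N = psum (fun m => mcoeff m (P N)) N.
  apply/mpolyP => m; rewrite mcoeff_psum [RHS]mcoeff_psum; case: ifP => [mN|//].
  rewrite /e /P !mcoeffM; apply: eq_bigr => -[k1 k2] _ /=.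
  by rewrite !mcoeff_psum !(leq_trans (bmdeg _) mN) !bmdeg.
have PM N : pnorm t (P N) <= M * M'.
  by rewrite (le_trans (pnormM _ _ (ltW t0)))// ler_pM ?pnorm_ge0// ltW.
exists e; apply/has_expansionP; exists (t / 2), (M * M').
have t2 : 0 < t / 2 by rewrite divr_gt0.
have t2t : t / 2 <= t by rewrite ler_pdivrMr// ler_peMr ?(ltW t0)// ler1n.
have eM N : pnorm t (psum e N) <= M * M'.
  by rewrite eP (le_trans (pnorm_trunc _ _ (ltW t0))).
split=> [//|N|z zt].
  by rewrite (le_trans _ (eM N))// pnorm_psum_le// ltW.
apply: (@cvg_geo_bound _ (fun N => meval (z 0) (P N)) _ (M * M' + M * M')); last first.
  under eq_cvg do rewrite mevalM.
  by apply: cvgM; [apply: cf|apply: dg] => j; rewrite (lt_le_trans (zt j)).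
move=> N; rewrite -mevalB (le_trans (norm_meval_le _ (fun j => ltW (zt j))))//.
apply: (le_trans (@pnorm_shrink _ _ t (t / 2) _ N (ltW t2) t2t t0 _)).
  by move=> m mN; rewrite mcoeffB eP mcoeff_psum mN subrr.
rewrite [t / 2]mulrC mulfK ?gt_eqF// mulrC ler_wpM2r ?exprn_ge0 ?invr_ge0//.
by rewrite (le_trans (pnormD _ _ (ltW t0)))// pnormN lerD.
Qed.

End Germs.

(** The difference [L - D] between a derivative and its approximation through a
    difference quotient, itself known only through approximations [S0] and [S1]
    of the values [F0] and [F1]. *)
Lemma difference_quotient_split (K : fieldType) (L D h F0 F1 S0 S1 : K) : h != 0 ->
  L - D = (L - h^-1 * (F1 - F0)) +
    (h^-1 * (F1 - S1) - h^-1 * (F0 - S0) + h^-1 * (S1 - S0 - h * D)).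
Proof. by move=> h0; field. Qed.

Section Derivative.
Context {R : realType} {n : nat}.
Local Notation C := (Cx R).
Local Notation poly := (mpoly n C).
Implicit Types (p q : poly) (c d : multinom n -> C) (r s h : C) (a z : 'rV[C]_n).
Implicit Types (f g : 'rV[C]_n -> C).

Definition dcoef i c : multinom n -> C := fun m => c (mnm_add m (mnm1 i)) *+ (m i).+1.

Lemma psum_dcoef i c N : psum (dcoef i c) N = mderiv i (psum c N.+1).
Proof.
apply/mpolyP => m; rewrite mcoeff_deriv !mcoeff_psum mdegD mdeg1 addn1 ltnS.
by case: ifP; rewrite ?mul0rn.
Qed.

Lemma pnorm_mderiv s i p : 0 < s -> pnorm s (mderiv i p) <= s^-1 * pnorm (2 * s) p.
Proof.
move=> s0; rewrite {1}[p]mpolyE [mderiv i _]raddf_sum /=.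
apply: (le_trans (pnorm_sum _ _ _ (ltW s0))).
rewrite /pnorm mulr_sumr; apply: ler_sum => m _; rewrite -/(pnorm _ _).
rewrite mderivZ mderivX scalerA pnormZX normrM normr_nat -mulrA [leRHS]mulrCA ler_wpM2l//.
have [->|mi] := eqVneq (m i) 0%N.
  by rewrite mul0r mulr_ge0 ?invr_ge0 ?exprn_ge0 ?mulr_ge0 ?(ltW s0).
have md : mdeg m = (mdeg (mnm_sub m (mnm1 i))).+1.
  rewrite -[in LHS](@submK _ (mnm1 i) m); last by rewrite lep1mP.
  by rewrite mdegD mdeg1 addn1.
rewrite [in leRHS]md (exprS (2 * s)) mulrA mulrCA mulVf ?gt_eqF// mulr1 exprMn mulrA.
rewrite ler_wpM2r ?exprn_ge0 ?(ltW s0)// -exprS -md -natrX ler_nat.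
apply: (@leq_trans (mdeg m)); last by rewrite ltnW// ltn_expl.
by rewrite mdegE (bigD1 i)//= leq_addr.
Qed.

(** Differentiating a power series at [a] requires derivatives at the points near
    [a]; holomorphy at these points provides them. *)
Definition holo_near f a : Prop := \forall x \near a, holomorphic_at f x.

Lemma holo_near_at f a : holo_near f a -> holomorphic_at f a.
Proof. exact: nbhs_singleton. Qed.

(** Term by term differentiation. The derivative [L] of [f] at [a + z] exists by
    hypothesis. For small [h] it is close to the difference quotient of [f],
    which is the limit of those of the partial sums, and [poly_taylor2] compares
    the latter to the derivatives of the partial sums uniformly in [N]. *)
Lemma has_expansion_partial f a c i : holo_near f a -> has_expansion f a c ->
  has_expansion (partial i f) a (dcoef i c).
Proof.
move=> /near_polydisc[s0 s00 fhol] /has_expansionP[r [M H]].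
have r0 : 0 < r by case: H.
have [t [t0 tr ts]] := exists_common_radius r0 s00.
have M0 := expands_M H.
have [_ cM cf] := expands_shrink t0 tr H.
pose s := t / 2.
have s2 : 0 < s by rewrite divr_gt0.
have ts2 : t = 2 * s by rewrite mulrC divfK.
apply/has_expansionP; exists s, (s^-1 * M); split=> [//|N|z zs].
  rewrite psum_dcoef (le_trans (pnorm_mderiv _ _ s2))// -ts2.
  by rewrite ler_wpM2l// invr_ge0 ltW.
have zt j : `|z 0 j| < t.
  by rewrite (lt_le_trans (zs j))// ts2 ler_peMl ?(ltW s2)// ler1n.
have [c' fc'] : holomorphic_at f (a + z).
  by apply: fhol => j; rewrite (lt_le_trans (zt j)).
rewrite (@has_expansion_partial_at _ _ _ _ _ i fc').
have := @ord_ge_linear_derive _ _ _ _ (fun j => c' (mnm1 j)) i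
  (has_expansion_linear fc').
set L := c' _ => /cvgrPdist_le fL.
apply/cvgrPdist_le => e e0.
have e1 : 0 < e / 4 by rewrite divr_gt0.
have K0 : 0 <= s ^- 2 * M by rewrite mulr_ge0// invr_ge0 exprn_ge0// ltW.
near (0 : C)^' => h.
have [h0 hs hK] : [/\ h != 0, `|h| <= s & `|h| * (s ^- 2 * M) <= e / 4].
  by near: h; exact: near0_small.
have hL : `|L - h^-1 *: ((f \o shift (a + z)) (h *: delta_mx 0 i) - f (a + z))| <= e / 4.
  by near: h; exact: fL.
have zht j : `|(z + h *: delta_mx 0 i) 0 j| < t.
  rewrite mxE (le_lt_trans (ler_normD _ _))// ts2 mulr_natl mulr2n ltr_leD// !mxE normrM.
  rewrite (le_trans _ hs)// ler_piMr//.
  by case: (_ && _); rewrite ?normr1 ?normr0.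
have e2 : 0 < e / 4 * `|h| by rewrite mulr_gt0// normr_gt0.
move/cvgrPdist_le: (cf _ zht) => /(_ _ e2)[N1 _ cfh].
move/cvgrPdist_le: (cf _ zt) => /(_ _ e2)[N0 _ cf0].
exists (maxn N0 N1) => // N /=; rewrite geq_max => /andP[N0N N1N].
have A1 := cfh N.+1 (leqW N1N); have A0 := cf0 N.+1 (leqW N0N).
have A2 := @poly_taylor2 _ _ (psum c N.+1) i z h s s2 (fun j => ltW (zs j)) hs.
have F1E : (f \o shift (a + z)) (h *: delta_mx 0 i) = f (a + (z + h *: delta_mx 0 i)).
  by rewrite /= addrC addrA.
rewrite {}F1E in hL; rewrite /= in A0 A1; rewrite psum_dcoef.
have B (x y : C) : `|x| <= y * `|h| -> `|h^-1 * x| <= y.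
  by move=> xy; rewrite normrM normfV ler_pdivrMl ?normr_gt0// mulrC.
rewrite (difference_quotient_split _ _ (f (a + z)) (f (a + (z + h *: delta_mx 0 i)))
  (meval (z 0) (psum c N.+1)) (meval ((z + h *: delta_mx 0 i) 0) (psum c N.+1)) h0).
rewrite (_ : e = e / 4 + (e / 4 + e / 4 + e / 4)); last by field.
apply: (le_trans (ler_normD _ _)); apply: lerD; first exact: hL.
apply: (le_trans (ler_normD _ _)); apply: lerD.
  by apply: (le_trans (ler_normB _ _)); apply: lerD; [exact: B A1|exact: B A0].
apply: B; apply: (le_trans A2).
rewrite expr_div_n -ts2 [`|h| ^+ 2]expr2 -(mulrA (`|h| * _)) -(mulrA `|h|) [leRHS]mulrC.
rewrite ler_wpM2l//; apply: le_trans hK; rewrite ler_wpM2l//.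
by rewrite ler_wpM2l ?invr_ge0 ?exprn_ge0// ltW.
Unshelve. all: by end_near. Qed.

End Derivative.

(** * Germs of holomorphic functions *)

Section NbhsImply.
Context {T : topologicalType}.
Implicit Types (a : T) (P Q S : set T).

Lemma nbhs_imply a P S : nbhs a P -> (forall x, P x -> S x) -> nbhs a S.
Proof. by move=> aP PS; apply: filterS aP. Qed.

Lemma nbhs_imply2 a P Q S : nbhs a P -> nbhs a Q ->
  (forall x, P x -> Q x -> S x) -> nbhs a S.
Proof. by move=> aP aQ PQS; apply: filterS2 aP aQ. Qed.

Lemma nbhs_imply_nbhs a P S : nbhs a P -> (forall x, nbhs x P -> S x) -> nbhs a S.
Proof. by move=> /nbhs_interior aP PS; apply: filterS aP. Qed.

End NbhsImply.

Section Holo.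
Context {R : realType} {n : nat}.
Local Notation C := (Cx R).
Local Notation poly := (mpoly n C).
Implicit Types (p q : poly) (c d : multinom n -> C) (r s h : C) (a z : 'rV[C]_n).
Implicit Types (f g : 'rV[C]_n -> C).

Lemma holo_near_cst b a : holo_near (fun=> b) a.
Proof.
near=> x; exists (fun m => if m == mnm0 then b else 0); exact: has_expansion_cst.
Unshelve. all: by end_near. Qed.

Lemma holo_nearD f g a :
  holo_near f a -> holo_near g a -> holo_near (fun x => f x + g x) a.
Proof.
move=> fa ga; apply: (nbhs_imply2 fa ga) => x [c fc] [d gd].
by exists (fun m => c m + d m); exact: has_expansionD.
Qed.

Lemma holo_nearM f g a :
  holo_near f a -> holo_near g a -> holo_near (fun x => f x * g x) a.
Proof.
move=> fa ga; apply: (nbhs_imply2 fa ga) => x [c fc] [d gd].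
exact: has_expansionM fc gd.
Qed.

Lemma holo_near_sum (I : Type) (s : seq I) (F : I -> 'rV[C]_n -> C) a :
  (forall i, holo_near (F i) a) -> holo_near (fun x => \sum_(i <- s) F i x) a.
Proof.
move=> H; elim: s => [|i s IH].
  by under eq_fun do rewrite big_nil; exact: holo_near_cst.
by under eq_fun do rewrite big_cons; apply: holo_nearD; [exact: H|exact: IH].
Qed.

Lemma holo_near_prod (I : Type) (s : seq I) (F : I -> 'rV[C]_n -> C) a :
  (forall i, holo_near (F i) a) -> holo_near (fun x => \prod_(i <- s) F i x) a.
Proof.
move=> H; elim: s => [|i s IH].
  by under eq_fun do rewrite big_nil; exact: holo_near_cst.
by under eq_fun do rewrite big_cons; apply: holo_nearM; [exact: H|exact: IH].
Qed.

Lemma holo_near_det (k : nat) (M : 'I_k -> 'I_k -> 'rV[C]_n -> C) a :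
  (forall i j, holo_near (M i j) a) ->
  holo_near (fun x => \det (\matrix_(i, j) M i j x)) a.
Proof.
move=> H; apply: holo_near_sum => s; apply: holo_nearM; first exact: holo_near_cst.
under eq_fun do under eq_bigr do rewrite mxE.
by apply: holo_near_prod => i; exact: H.
Qed.

Lemma holo_near_partial f a (i : 'I_n) : holo_near f a -> holo_near (partial i f) a.
Proof.
move=> fa; apply: (nbhs_imply_nbhs fa) => x fx.
have [c fc] : holomorphic_at f x by exact: holo_near_at fx.
by exists (dcoef i c); exact: has_expansion_partial fx fc.
Qed.

Lemma near_eq_partial f g a i : (\near a, f a = g a) -> partial i f a = partial i g a.
Proof. exact: near_eq_derive. Qed.

Lemma partial_cst b a i : partial i (fun=> b) a = 0.
Proof. exact: derive_cst. Qed.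

Lemma near_eq0_partial f a i : (\forall x \near a, f x = 0) ->
  \forall x \near a, partial i f x = 0.
Proof.
move=> fa; apply: (nbhs_imply_nbhs fa) => x fx.
by rewrite -(partial_cst 0 x i); apply: near_eq_partial.
Qed.

Lemma has_expansion0 f a c : has_expansion f a c -> (forall m, c m = 0) ->
  \forall x \near a, f x = 0.
Proof.
move=> /has_expansionP[r [M [r0 _ cf]]] c0; apply/near_polydisc; exists r => // z zr.
have : (fun N => meval (z 0) (psum c N)) @ \oo --> (0 : C).
  apply: cvg_near_cst; apply: nearW => N; rewrite /psum big1 ?meval0// => m _.
  by rewrite c0 scale0r.
by apply: cvg_unique (cf z zr); exact: norm_hausdorff.
Qed.

Definition zero_accum f a : Prop :=
  forall V, nbhs a V -> exists2 x, V x & \forall y \near x, f y = 0.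

(** The identity theorem at a limit point: all iterated derivatives of [f] are
    continuous and vanish arbitrarily close to [a], hence vanish at [a]. *)
Lemma zero_accum_coef f a c m : holo_near f a -> zero_accum f a ->
  has_expansion f a c -> c m = 0.
Proof.
elim: {m}(mdeg m) {-2}m (erefl (mdeg m)) f c => [|k IH] m mk f c fh fz fc.
  have /eqP -> : m == mnm0 by rewrite -mdeg_eq0 mk.
  rewrite -(has_expansion_at fc).
  have [r [K [r0 K0 H]]] := has_expansion_ord_ge 1 fc.
  apply/eqP; rewrite -normr_eq0; apply/eqP.
  have r2 : 0 < r / 2 by rewrite divr_gt0.
  apply: (small_eq0 (normr_ge0 _) K0 r2) => h h0 hr.
  have [|x Vx /nbhs_singleton fx] := fz [set x | forall j, `|(x - a) 0 j| < h].
    by apply/near_polydisc; exists h => // z zh j; rewrite addrC addKr.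
  have := H h (x - a) (ltW h0); rewrite (addrC a) subrK fx.
  have -> : meval ((x - a) 0) (psum c 1) = f a.
    by rewrite (has_expansion_at fc) psum1 mevalC.
  rewrite sub0r normrN mulrC; apply.
    by apply: le_lt_trans hr _; rewrite ltr_pdivrMr// ltr_pMr// ltr1n.
  by move=> j; exact/ltW/Vx.
have [i [m' [-> m'k]]] := mdeg_succ mk.
have H := IH _ m'k _ _ (holo_near_partial i fh) _ (has_expansion_partial i fh fc).
have /eqP : c (mnm_add m' (mnm1 i)) *+ (m' i).+1 = 0.
  apply: H => V /fz[x Vx fx].
  by exists x => //; exact: near_eq0_partial.
by rewrite mulrn_eq0 => /eqP.
Qed.

Lemma zero_accum_near0 f a : holo_near f a -> zero_accum f a ->
  \forall x \near a, f x = 0.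
Proof.
move=> fh fz; have [c fc] := holo_near_at fh.
by apply: (has_expansion0 fc) => m; exact: zero_accum_coef fh fz fc.
Qed.

Lemma leastP (A : set nat) e0 : A e0 -> A (least A) /\ forall e, A e -> (least A <= e)%N.
Proof.
move=> Ae0; rewrite /least; case: xgetP => [e _ []//|H].
have exA : exists e, `[< A e >] by exists e0; apply/asboolP.
case: (ex_minnP exA) => e /asboolP Ae emin; case: (H e); split=> // e' Ae'.
by apply: emin; apply/asboolP.
Qed.

Section LowestDegree.
Variables (f : 'rV[C]_n -> C) (a : 'rV[C]_n).
Hypothesis (fh : holomorphic_at f a) (f0 : ~ \forall x \near a, f x = 0).

Lemma low_degP : (exists m, taylor f a m != 0 /\ mdeg m = low_deg f a) /\
  forall m, (mdeg m < low_deg f a)%N -> taylor f a m = 0.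
Proof.
have [m m0] : exists m, taylor f a m != 0.
  apply: contra_notP f0 => H; apply: (has_expansion0 (holomorphic_taylor fh)) => m.
  by apply/eqP/negPn/negP => m0; apply: H; exists m.
have [|[m' H'] H] := @leastP [set e | exists m, taylor f a m != 0 /\ mdeg m = e] (mdeg m).
  by exists m.
split; first by exists m'.
move=> k kl; apply/eqP/negPn/negP => k0.
by have := H (mdeg k); rewrite leqNgt kl => /(_ (ex_intro _ k (conj k0 erefl))).
Qed.

Lemma mcoeff_low m : mcoeff m (low f a) =
  if mdeg m == low_deg f a then taylor f a m else 0.
Proof.
rewrite /low big_mkcond /= -[RHS](if_same (mdeg m < (low_deg f a).+1)%N).
have -> : \sum_(i : bmultinom n (low_deg f a).+1)
     (if mdeg i == low_deg f a then taylor f a i *: mpolyX C i else 0) =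
   psum (fun m => if mdeg m == low_deg f a then taylor f a m else 0) (low_deg f a).+1.
  by apply: eq_bigr => k _; case: ifP => // _; rewrite scale0r.
rewrite mcoeff_psum; case: ifP => // /negbT.
by rewrite -leqNgt => H; rewrite gtn_eqF.
Qed.

Lemma low_neq0 : low f a != 0.
Proof.
have [[m [m0 mE]] _] := low_degP.
apply: contraNneq m0 => g0; have := mcoeff_low m.
by rewrite g0 mcoeff0 mE eqxx => <-.
Qed.

Lemma low_homog m : mdeg m != low_deg f a -> mcoeff m (low f a) = 0.
Proof. by rewrite mcoeff_low => /negPf ->. Qed.

Lemma psum_low : psum (taylor f a) (low_deg f a).+1 = low f a.
Proof.
apply/mpolyP => m; rewrite mcoeff_psum mcoeff_low ltnS.
case: ltngtP => // ml; have [_ ->//] := low_degP.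
Qed.

Lemma ord_ge_low : ord_ge (fun x => f x - meval ((x - a) 0) (low f a)) a (low_deg f a).+1.
Proof. by rewrite -psum_low; exact/has_expansion_ord_ge/holomorphic_taylor. Qed.

Lemma ord_ge_low_deg : ord_ge f a (low_deg f a).
Proof.
have [_ H] := low_degP.
exact/(has_expansion_ord_geP _ (holomorphic_taylor fh)).
Qed.

Lemma ord_ge_partial_low i : holo_near f a ->
  ord_ge (fun x => partial i f x - meval ((x - a) 0) (mderiv i (low f a))) a (low_deg f a).
Proof.
move=> fhn; rewrite -psum_low -psum_dcoef.
by apply: has_expansion_ord_ge; exact: has_expansion_partial (holomorphic_taylor fh).
Qed.

End LowestDegree.

(** Up to the degree [d] the Taylor coefficients of [f] are those of [g]. *)
Lemma low_deg_eq f a (g : poly) (d : nat) : holomorphic_at f a -> g != 0 ->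
  (forall m, mdeg m != d -> mcoeff m g = 0) ->
  ord_ge (fun x => f x - meval ((x - a) 0) g) a d.+1 -> low_deg f a = d.
Proof.
move=> fh g0 gd H.
have H1 : ord_ge (fun x => meval ((x - a) 0) (psum (taylor f a) d.+1 - g)) a d.+1.
  have := ord_geB H (has_expansion_ord_ge d.+1 (holomorphic_taylor fh)).
  apply: ord_ge_eqfun => x; rewrite mevalB opprB addrC addrA subrK//.
have cE m : (mdeg m < d.+1)%N -> taylor f a m = mcoeff m g.
  move=> md; have := ord_ge_poly_coef H1 md.
  by rewrite mcoeffB mcoeff_psum md => /eqP; rewrite subr_eq0 => /eqP.
have [m gm] : exists m, mcoeff m g != 0.
  apply: contrapT => H2; move/eqP: g0; apply; apply/mpolyP => m.
  by rewrite mcoeff0; apply/eqP/negPn/negP => H3; apply: H2; exists m.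
have md : mdeg m = d by apply/eqP; apply: contraNT gm => /gd ->.
have [|[m' [m'0 m'E]] le] := @leastP [set e | exists m, taylor f a m != 0 /\ mdeg m = e] d.
  by exists m; rewrite cE ?md.
apply/eqP; rewrite eqn_leq le /=; last by exists m; rewrite cE ?md.
rewrite leqNgt; apply/negP => ld; move/eqP: m'0; apply.
rewrite cE ?m'E ?(ltnW ld)//; last exact: leqW.
by rewrite gd// m'E; rewrite neq_ltn ld.
Qed.

End Holo.

(** * Lowest degree terms of a log-canonical system *)

(** Telescoping: the three factors are replaced one at a time. *)
Lemma prod3_sub (K : comNzRingType) (x y z x' y' z' : K) :
  x * y * z - x' * y' * z' =
  - ((x' - x) * y * z + x' * (y' - y) * z + x' * y' * (z' - z)).
Proof. by ring. Qed.

Section LogCanonical.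
Context {R : realType} {n : nat}.
Local Notation C := (Cx R).
Local Notation poly := (mpoly n C).
Implicit Types (f g : 'rV[C]_n -> C).

Lemma mderiv_homog (p : poly) d i :
  p \is ishomog1 d.+1 mdeg -> mderiv i p \is ishomog1 d mdeg.
Proof.
move=> /dhomogP hp; apply/dhomogP => m; rewrite mcoeff_msupp mcoeff_deriv => pm.
have /hp : mnm_add m (mnm1 i) \in msupp p.
  by rewrite mcoeff_msupp; apply: contraNneq pm => ->; rewrite mul0rn.
by move=> /=; rewrite mdegD mdeg1 addn1 => -[].
Qed.

Lemma mderiv_homog0 (p : poly) i : p \is ishomog1 0 mdeg -> mderiv i p = 0.
Proof.
move=> /dhomogP hp; apply/mpolyP => m; rewrite mcoeff_deriv mcoeff0.
rewrite [mcoeff _ _](_ : _ = 0) ?mul0rn//; apply: contrapT => /eqP.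
by rewrite -mcoeff_msupp => /hp /=; rewrite mdegD mdeg1 addn1.
Qed.

Lemma homog_coef0 (p : poly) d : p \is ishomog1 d mdeg ->
  forall m, mdeg m != d -> mcoeff m p = 0.
Proof. by move=> hp m md; exact: dhomog_nemf_coeff hp md. Qed.

Lemma ord_ge_homog (p : poly) d a : p \is ishomog1 d mdeg ->
  ord_ge (fun x => meval ((x - a) 0) p) a d.
Proof.
move=> hp; apply: ord_ge_poly => m md; apply: (homog_coef0 hp).
by rewrite neq_ltn md.
Qed.

Lemma ord_ge_det (k : nat) (M : 'rV[C]_n -> 'M[C]_k) (e : 'I_k -> nat) a :
  (forall i j, ord_ge (fun x => M x i j) a (e i)) ->
  ord_ge (fun x => \det (M x)) a (\sum_i e i)%N.
Proof.
move=> H; apply: ord_ge_sum => s _; apply: ord_geZ.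
have := @ord_ge_prod _ _ _ (index_enum 'I_k)
  (fun i x => M x i (perm.fun_of_perm s i)) e a; apply => i; exact: H.
Qed.

Lemma ord_ge_prodB (I : Type) (s : seq I) (F G : I -> 'rV[C]_n -> C) (e : I -> nat) a :
  (forall i, ord_ge (F i) a (e i)) -> (forall i, ord_ge (G i) a (e i)) ->
  (forall i, ord_ge (fun x => F i x - G i x) a (e i).+1) ->
  ord_ge (fun x => \prod_(i <- s) F i x - \prod_(i <- s) G i x) a (\sum_(i <- s) e i).+1.
Proof.
move=> HF HG HB; elim: s => [|i s IH].
  rewrite big_nil; apply: ord_ge_eqfun (ord_ge0 a 1) => x.
  by rewrite !big_nil subrr.
rewrite big_cons.
have H1 := ord_geM (HB i) (ord_ge_prod s HF).
have H2 := ord_geM (HG i) IH; rewrite addnS in H2.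
apply: ord_ge_eqfun (ord_geD H1 H2) => x; rewrite !big_cons mulrBl mulrBr.
by rewrite addrA subrK.
Qed.

Lemma homog_prod_seq (I : Type) (s : seq I) (G : I -> poly) (e : I -> nat) :
  (forall i, G i \is ishomog1 (e i) mdeg) ->
  \prod_(i <- s) G i \is ishomog1 (\sum_(i <- s) e i)%N mdeg.
Proof.
move=> H; elim: s => [|i s IH]; first by rewrite !big_nil dhomog1.
by rewrite !big_cons dhomogM.
Qed.

Variables (f : 'I_n -> 'rV[C]_n -> C).
Hypothesis fh : forall i, holo_near (f i) 0.
Hypothesis jac_neq0 : ~ \forall x \near (0 : 'rV[C]_n), dwedge f id x = 0.

Let e i := low_deg (f i) 0.
Let g i := low (f i) 0.

Lemma component_germ_neq0 i : ~ \forall x \near (0 : 'rV[C]_n), f i x = 0.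
Proof.
move=> fi0; apply: jac_neq0; apply: (nbhs_imply_nbhs fi0) => x fx.
rewrite /dwedge (expand_det_row _ i) big1// => j _; rewrite mxE.
by rewrite (near_eq_partial (g := fun=> 0) j fx) partial_cst mul0r.
Qed.

Lemma dhomog_low i : g i \is ishomog1 (e i) mdeg.
Proof.
apply/dhomogP => m; rewrite mcoeff_msupp => gm; apply: contrapT => /eqP me.
by move: gm; rewrite /g low_homog ?eqxx.
Qed.

Lemma ord_ge_component i : ord_ge (f i) 0 (e i).
Proof. by apply: ord_ge_low_deg; [exact: holo_near_at|exact: component_germ_neq0]. Qed.

Lemma ord_ge_sub_low i : ord_ge (fun x => f i x - meval ((x - 0) 0) (g i)) 0 (e i).+1.
Proof. by apply: ord_ge_low; [exact: holo_near_at|exact: component_germ_neq0]. Qed.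

Lemma ord_ge_partial_sub_low i j :
  ord_ge (fun x => partial j (f i) x - meval ((x - 0) 0) (mderiv j (g i))) 0 (e i).
Proof. by apply: ord_ge_partial_low; [exact: holo_near_at|exact: component_germ_neq0|]. Qed.

Lemma ord_ge_mderiv_low i j :
  ord_ge (fun x => meval ((x - 0) 0) (mderiv j (g i))) 0 (e i).-1.
Proof.
have := dhomog_low i.
case: (e i) => [/mderiv_homog0 ->|d /mderiv_homog/ord_ge_homog]; last exact.
by apply: ord_ge_eqfun (ord_ge0 _ _) => x; rewrite meval0.
Qed.

Lemma low_deg_prod : low_deg (fun x => \prod_(i < n) f i x) 0 = (\sum_i e i)%N.
Proof.
apply: (@low_deg_eq _ _ _ _ (\prod_i g i)).
- by apply: holo_near_at; apply: holo_near_prod.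
- apply/prodf_neq0 => i _.
  by apply: low_neq0; [exact: holo_near_at|exact: component_germ_neq0].
- exact/homog_coef0/homog_prod_seq/dhomog_low.
have := ord_ge_prodB (index_enum 'I_n) ord_ge_component
  (fun i => ord_ge_homog 0 (dhomog_low i)) ord_ge_sub_low.
by apply: ord_ge_eqfun => x; rewrite rmorph_prod.
Qed.

Definition low_jacobian : 'M[poly]_n := \matrix_(i, j) mderiv j (g i).
Let M := map_mx (@tofrac poly) low_jacobian.
Let r := \rank M.

(** Split each row as [d f_i = d g_i + d (f_i - g_i)] and expand the determinant.
    A term with more than [r] rows among the [d g_i] vanishes. In the others at
    most [r] rows have order [e i - 1], and the rows [d (f_i - g_i)] gain one
    degree. *)
Lemma ord_ge_dwedge (J : 'I_n -> 'I_n) : ord_ge (dwedge f J) 0 (\sum_i e i - r)%N.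
Proof.
pose A (x : 'rV[C]_n) := \matrix_(i, j) meval ((x - 0) 0) (mderiv (J j) (g i)).
pose B (x : 'rV[C]_n) :=
  \matrix_(i, j) (partial (J j) (f i) x - meval ((x - 0) 0) (mderiv (J j) (g i))).
pose D (S : {set 'I_n}) x := \matrix_(i, j) (if i \in S then A x i j else B x i j).
have E x : \sum_(S : {set 'I_n}) \det (D S x) = dwedge f J x.
  rewrite /dwedge -det_add_sum; congr (\det _); apply/matrixP => i j.
  by rewrite !mxE addrC subrK.
apply: ord_ge_eqfun E _; apply: ord_ge_sum => S _.
have [rS|Sr] := ltnP r #|S|.
  apply: ord_ge_eqfun (ord_ge0 _ _) => x; rewrite det_mixed_eq0//.
  apply: leq_ltn_trans rS; rewrite /r /M.
  have -> : A x = colsub J (map_mx (meval ((x - 0) 0)) low_jacobian).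
    by apply/matrixP => i j; rewrite !mxE.
  exact: leq_trans (mxrank_colsub_le _ _) (mxrank_specialize _ _).
have H : ord_ge (fun x => \det (D S x)) 0 (\sum_i (if i \in S then (e i).-1 else e i)).
  apply: ord_ge_det => i j; case: ifP => iS.
    by apply: ord_ge_eqfun (ord_ge_mderiv_low i (J j)) => x; rewrite !mxE iS.
  by apply: ord_ge_eqfun (ord_ge_partial_sub_low i (J j)) => x; rewrite !mxE iS.
apply: ord_ge_le H; rewrite leq_subLR -(leq_add2r #|S|) in Sr *.
apply: (@leq_trans (\sum_i (if i \in S then (e i).-1 else e i) + #|S|)); last first.
  by rewrite addnC leq_add2r -(leq_add2r #|S|).
rewrite -sum1_card [X in (_ <= _ + X)%N]big_mkcond -big_split /=; apply: leq_sum => i _.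
by case: ifP => _; rewrite ?addn0// addn1 leqSpred.
Qed.

(** As a form, [d f_0 /\ ... /\ d f_(n-1)] has [n] added to the degree of its
    coefficients, and the product of the [f_i] has degree [\sum_i e i]. *)
Lemma log_volume_low_deg_ge : n%:Z - r%:Z <= log_volume_low_deg f 0.
Proof.
rewrite /log_volume_low_deg /mero_low_deg low_deg_prod /form_low_deg.
have dh J : holomorphic_at (dwedge f J) 0.
  apply: holo_near_at; apply: holo_near_det => i j.
  exact: holo_near_partial.
have [m m0] : exists m, taylor (dwedge f id) 0 m != 0.
  apply: contra_notP jac_neq0 => H.
  apply: (has_expansion0 (holomorphic_taylor (dh id))) => m.
  by apply/eqP/negPn/negP => m0; apply: H; exists m.
set A := [set d | _].
have [[J [k [k0 <-]]] _] : A (least A) /\ forall e, A e -> (least A <= e)%N.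
  by apply: (@leastP _ (mdeg m)); exists id, m.
have H : (\sum_i e i - r <= mdeg k)%N.
  rewrite leqNgt; apply/negP => kl; move/eqP: k0; apply.
  have [H _] := has_expansion_ord_geP (\sum_i e i - r) (holomorphic_taylor (dh J)).
  exact: (H (ord_ge_dwedge J)).
rewrite lerBlDr addrAC lerBrDr -!PoszD lez_nat (addnC (mdeg k)) -addnA leq_add2l.
by rewrite addnC -leq_subLR.
Qed.

Variables (w : 'I_n -> 'I_n -> 'rV[C]_n -> C) (pi0 : 'M[poly]_n).
Hypothesis pi0_lin : forall a b, pi0 a b \is ishomog1 1 mdeg.
Hypothesis w_pi0 : forall a b, ord_ge (fun x => w a b x - meval ((x - 0) 0) (pi0 a b)) 0 2.
Hypothesis f_log : forall i j, exists l : C, \forall x \near (0 : 'rV[C]_n),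
  \sum_a \sum_b w a b x * partial a (f i) x * partial b (f j) x = l * (f i x * f j x).

(** The component of degree [e i + e j - 1] of [{f_i, f_j} = l f_i f_j] is
    [{g_i, g_j} = 0]: on the left, replacing [w], [d f_i] and [d f_j] by their
    lowest degree terms only changes terms of degree at least [e i + e j]. *)
Lemma low_commute i j : poly_bracket pi0 (g i) (g j) = 0.
Proof.
have gi := dhomog_low i; have gj := dhomog_low j.
have [l fl] := f_log i j.
have Fi a := ord_ge_partial_sub_low i a; have Fj a := ord_ge_partial_sub_low j a.
have Gi a := ord_ge_mderiv_low i a; have Gj a := ord_ge_mderiv_low j a.
have fi := ord_ge_component i; have fj := ord_ge_component j.
(* If e i = 0 or e j = 0, then one of g_i, g_j is constant. *)
case: (e i) gi Fi Gi fi => [gi _ _ _|p gi Fi Gi fi].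
  by apply: big1 => a _; apply: big1 => b _; rewrite mderiv_homog0 ?mulr0 ?mul0r.
case: (e j) gj Fj Gj fj => [gj _ _ _|q gj Fj Gj fj].
  by apply: big1 => a _; apply: big1 => b _; rewrite (mderiv_homog0 b gj) mulr0.
rewrite /= in Gi Gj.
have Bh : poly_bracket pi0 (g i) (g j) \is ishomog1 (p + q).+1 mdeg.
  apply: rpred_sum => a _; apply: rpred_sum => b _.
  rewrite (_ : (p + q).+1 = (1 + p + q)%N)//.
  by apply: dhomogM; [apply: dhomogM => //|]; exact: mderiv_homog.
apply: (@homog_ord_ge_eq0 _ _ _ 0 (p + q).+1); first exact: homog_coef0 Bh.
have ffO : ord_ge (fun x => \sum_a \sum_b w a b x * partial a (f i) x * partial b (f j) x)
    0 (p + q).+2.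
  have H : ord_ge (fun x => l * (f i x * f j x)) 0 (p + q).+2.
    by apply: ord_geZ; have := ord_geM fi fj; rewrite addSn addnS.
  apply: ord_ge_near H; apply: (nbhs_imply fl) => x ->; exact: erefl.
have WO a b : ord_ge (w a b) 0 1.
  have := ord_geD (ord_ge_le (leqnSn 1) (w_pi0 a b)) (ord_ge_homog 0 (pi0_lin a b)).
  by apply: ord_ge_eqfun => x; rewrite subrK.
have FiO a : ord_ge (partial a (f i)) 0 p.
  have := ord_geD (ord_ge_le (leqnSn p) (Fi a)) (Gi a).
  by apply: ord_ge_eqfun => x; rewrite subrK.
pose T (a b : 'I_n) (x : 'rV[C]_n) : C :=
  meval ((x - 0) 0) (pi0 a b) * meval ((x - 0) 0) (mderiv a (g i))
    * meval ((x - 0) 0) (mderiv b (g j))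
  - w a b x * partial a (f i) x * partial b (f j) x.
have TO : ord_ge (fun x => \sum_a \sum_b T a b x) 0 (p + q).+2.
  apply: ord_ge_sum => a _; apply: ord_ge_sum => b _.
  have H1 := ord_geM (ord_geM (w_pi0 a b) (Gi a)) (Gj b).
  have H2 := ord_geM (ord_geM (WO a b) (Fi a)) (Gj b).
  have H3 := ord_geM (ord_geM (WO a b) (FiO a)) (Fj b).
  rewrite (_ : (2 + p + q)%N = (p + q).+2) in H1; last by rewrite -addnA.
  rewrite (_ : (1 + p.+1 + q)%N = (p + q).+2) in H2; last by rewrite add1n !addSn.
  rewrite (_ : (1 + p + q.+1)%N = (p + q).+2) in H3; last by rewrite add1n addSn addnS.
  apply: ord_ge_eqfun (ord_geN (ord_geD (ord_geD H1 H2) H3)) => x.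
  exact/esym/prod3_sub.
have := ord_geD TO ffO; apply: ord_ge_eqfun => x.
rewrite -big_split /= raddf_sum /=; apply: eq_bigr => a _.
rewrite -big_split /= raddf_sum /=; apply: eq_bigr => b _.
by rewrite /T subrK !rmorphM.
Qed.

Lemma poisson_rank_le : (poisson_rank pi0 <= \rank (map_mx (@tofrac poly) pi0))%N.
Proof.
apply/bigmax_leqP => k /asboolP[x <-].
exact: (mxrank_specialize (meval x : {rmorphism poly -> C})).
Qed.

(** The differentials of the commuting [g_i] span an isotropic subspace over the
    field of rational functions. *)
Lemma rank_low_jacobian : (r + r + poisson_rank pi0 <= n + n)%N.
Proof.
apply: leq_trans (mxrank_isotropic (M := M) (w := map_mx (@tofrac poly) pi0) _).
  by rewrite leq_add2l poisson_rank_le.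
rewrite /M matrix.map_trmx -!map_mxM; apply/matrixP => i j; rewrite !mxE.
rewrite -[RHS](rmorph0 (@tofrac poly)); congr (tofrac _).
rewrite -[RHS](low_commute i j) /poly_bracket exchange_big /=.
apply: eq_bigr => b _; rewrite !mxE mulr_suml; apply: eq_bigr => a _.
by rewrite !mxE; congr (_ * _); rewrite mulrC.
Qed.

(** [rank_low_jacobian] and [log_volume_low_deg_ge] give
    [half_rk <= n - r <= deg_mu]. If the extreme terms agree then [r] is
    [n - half_rk], and [r] functions [g_i] with independent differentials form
    the integrable system. *)
Lemma log_canonical_local :
  let deg_mu : rat := (log_volume_low_deg f 0)%:~R in
  let half_rk : rat := (poisson_rank pi0)%:R / 2 in
  (deg_mu <= half_rk <-> deg_mu = half_rk) /\
  (deg_mu = half_rk ->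
   exists s : seq poly,
     poly_integrable_system pi0 s /\
     {subset s <= [seq low (f i) 0 | i <- enum 'I_n]}).
Proof.
move=> deg_mu half_rk.
have H1 : n%:R - r%:R <= deg_mu.
  have := log_volume_low_deg_ge.
  by rewrite -(ler_int rat) rmorphB.
have H2 : half_rk <= n%:R - r%:R.
  have := rank_low_jacobian; rewrite -(ler_nat rat) !natrD => H.
  rewrite /half_rk; lra.
split; first by split=> [|-> //]; move=> H; apply/eqP; rewrite eq_le H; lra.
move=> degE.
have nr : n%:R - r%:R = half_rk by lra.
have [k [kr [fR freeR]]] : exists k, k = r /\
    exists fR : 'I_k -> 'I_n, row_free (rowsub fR M).
  by exists r; split=> //; exists (maxrankfun M); exact: maxrowsub_free.
pose s := [seq g (fR i) | i <- enum 'I_k].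
have ss : size s = k by rewrite size_map size_enum_ord.
have freeM : row_free (\matrix_(i < size s, j < n) tofrac (mderiv j (tnth (in_tuple s) i))).
  rewrite (_ : \matrix_(_, _) _ = rowsub (cast_ord ss) (rowsub fR M)).
    exact: row_free_cast.
  by apply/matrixP => i j; rewrite !mxE (tnth_map_enum ss).
exists s; split; last first.
  by move=> p /mapP[i _ ->]; apply/mapP; exists (fR i); rewrite ?mem_enum.
split.
- suff gfR_inj : injective (fun i => g (fR i)).
    by rewrite /s (map_inj_uniq gfR_inj) enum_uniq.
  move=> i j gij; apply/eqP; apply: contraT => ij; have /row_freeP[N MN] := freeR.
  have : row i (rowsub fR M) = row j (rowsub fR M).
    by apply/rowP => l; rewrite !mxE -/(g (fR i)) gij.
  move=> /(congr1 (mulmx^~ N)); rewrite -!row_mul MN => /rowP/(_ i).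
  by rewrite !mxE eqxx eq_sym (negPf ij) => /eqP; rewrite oner_eq0.
- by rewrite ss kr -/half_rk -nr opprB addrC subrK.
- exact: jacobian_alg_independent freeM.
- move=> p q /mapP[i _ ->] /mapP[j _ ->]; exact: low_commute.
Qed.

End LogCanonical.

(** * The Jacobian of a log-canonical system on a connected open set *)

Section ChainRule.
Context {R : realType} {n : nat}.
Local Notation C := (Cx R).
Implicit Types (a b : 'rV[C]_n) (f : 'rV[C]_n -> C) (T : 'rV[C]_n -> 'rV[C]_n).

Lemma ord_ge_comp f T a k : ord_ge f (T a) k ->
  (forall j, ord_ge (fun x => T x 0 j - T a 0 j) a 1) -> ord_ge (f \o T) a k.
Proof.
move=> [r [K [r0 K0 H]]] HT.
have [rT HT1] := choice HT; have {HT HT1}[KT HT] := choice HT1.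
have rT0 j : 0 < rT j by have [] := HT j.
have KT0 j : 0 <= KT j by have [] := HT j.
pose L := 1 + \sum_j KT j.
have L0 : 0 < L by rewrite ltr_pwDl// sumr_ge0.
have LK j : KT j <= L.
  by rewrite /L (bigD1 j)//= addrCA lerDl addr_ge0// sumr_ge0.
(* u^-1 is below every rT j, and L times it is below r. *)
pose u := L / r + \sum_j (rT j)^-1.
have u0 : 0 < u by rewrite ltr_pwDl ?divr_gt0// sumr_ge0// => j _; rewrite invr_ge0 ltW.
exists u^-1, (K * L ^+ k); split.
- by rewrite invr_gt0.
- by rewrite mulr_ge0 ?exprn_ge0 ?(ltW L0).
move=> s z s0 su zs.
have su1 : s * u < 1 by rewrite -ltr_pdivlMr// mul1r.
have sr : L * s < r.
  rewrite -[ltRHS]mul1r -ltr_pdivrMr// mulrAC mulrC; apply: le_lt_trans su1.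
  by rewrite ler_wpM2l// lerDl sumr_ge0// => j _; rewrite invr_ge0 ltW.
have sT j : s < rT j.
  rewrite -[ltRHS]mul1r -ltr_pdivrMr//; apply: le_lt_trans su1.
  rewrite ler_wpM2l// /u (bigD1 j)//= addrCA lerDl addr_ge0 ?divr_ge0 ?(ltW L0) ?(ltW r0)//.
  by rewrite sumr_ge0// => i _; rewrite invr_ge0 ltW.
rewrite /= -[T (a + z)](subrK (T a)) [_ + T a]addrC -mulrA -exprMn; apply: H => //.
  by rewrite mulr_ge0// ltW.
move=> j; rewrite !mxE; have [_ _ /(_ s z s0 (sT j) zs)] := HT j.
by rewrite expr1 => /le_trans; apply; rewrite ler_wpM2r.
Qed.

(** Substitution of the first order Taylor formulas of the [T x 0 k] into that of
    [f]. *)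
Lemma partial_comp f T a j : holomorphic_at f (T a) ->
  (forall k, holomorphic_at (fun x => T x 0 k) a) ->
  partial j (f \o T) a = \sum_k partial k f (T a) * partial j (fun x => T x 0 k) a.
Proof.
move=> [c fc] HT; have [t Ht] := choice HT.
have TO k : ord_ge (fun x => T x 0 k - T a 0 k) a 1.
  have := has_expansion_ord_ge 1 (Ht k); apply: ord_ge_eqfun => x.
  by rewrite (has_expansion_at (Ht k)) psum1 mevalC.
pose L j := \sum_k c (mnm1 k) * t k (mnm1 j).
have H : ord_ge (fun x => (f \o T) x - (f \o T) a - \sum_j L j * (x - a) 0 j) a 2.
  have H1 := ord_ge_comp (has_expansion_linear fc) TO.
  have H2 : ord_ge (fun x => \sum_k c (mnm1 k) *
      (T x 0 k - T a 0 k - \sum_j t k (mnm1 j) * (x - a) 0 j)) a 2.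
    by apply: ord_ge_sum => k _; apply: ord_geZ; exact: has_expansion_linear (Ht k).
  apply: ord_ge_eqfun (ord_geD H1 H2) => x /=.
  rewrite -addrA; congr (_ + _).
  have -> : \sum_j0 L j0 * (x - a) 0 j0 =
      \sum_k c (mnm1 k) * (\sum_j0 t k (mnm1 j0) * (x - a) 0 j0).
    under eq_bigr do rewrite mulr_suml; rewrite exchange_big /=.
    apply: eq_bigr => k _; rewrite mulr_sumr; apply: eq_bigr => i _.
    by rewrite mulrA.
  rewrite -!sumrN -big_split /=; apply: eq_bigr => k _.
  have -> : (T x - T a) 0 k = T x 0 k - T a 0 k by rewrite !mxE.
  by rewrite [X in _ + X]mulrBr addKr.
rewrite (ord_ge_linear_partial (L := L) j H); apply: eq_bigr => k _.
by rewrite (has_expansion_partial_at _ fc) (has_expansion_partial_at _ (Ht k)).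
Qed.

Lemma partial_coord (i k : 'I_n) a : partial i (fun x => x 0 k) a = (k == i)%:R.
Proof.
apply: (ord_ge_linear_partial (L := fun j => (k == j)%:R)).
apply: ord_ge_eqfun (ord_ge0 a 2) => x.
rewrite (bigD1 k)//= eqxx mul1r big1 ?addr0 ?mxE ?subrr//.
by move=> j jk; rewrite eq_sym (negPf jk) mul0r.
Qed.

Lemma dwedge_eq0 (f : 'I_n -> 'rV[C]_n -> C) J x :
  dwedge f id x = 0 -> dwedge f J x = 0.
Proof.
move=> f0; rewrite /dwedge.
rewrite (_ : \matrix_(i, j) _ = (\matrix_(i, j) partial j (f i) x) *m
   (\matrix_(k, j) (k == J j)%:R)).
  by rewrite det_mulmx [X in X * _]f0 mul0r.
apply/matrixP => i j; rewrite !mxE (bigD1 (J j))//= !mxE eqxx mulr1 big1 ?addr0//.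
by move=> l lJ; rewrite !mxE (negPf lJ) mulr0.
Qed.

End ChainRule.

Section Charts.
Context {R : realType} {n : nat} (P : complex_manifold R n).
Local Notation C := (Cx R).
Implicit Types (c d : chart R n P) (p q : P) (U : set P) (Psi : P -> C).

Lemma near_image c p : cdom c p -> nbhs (cmap c p) (cmap c @` cdom c).
Proof. by move=> cp; apply: open_nbhs_nbhs; split; [exact: cimg_open|exists p]. Qed.

Lemma near_cinv c p U : cdom c p -> nbhs p U ->
  \forall x \near cmap c p, [/\ cdom c (cinv c x), cmap c (cinv c x) = x & U (cinv c x)].
Proof.
move=> cp pU.
have cont : {in cmap c @` cdom c, continuous (cinv c)}.
  by rewrite -(continuous_open_subspace _ (@cimg_open _ _ _ c)); exact: cinv_cont.
have H1 : nbhs (cmap c p) (cinv c @^-1` U).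
  apply: cont; first by rewrite inE; exists p.
  by rewrite (cmapK cp).
apply: (nbhs_imply2 (near_image cp) H1) => x [q cq <-].
by rewrite /= (cmapK cq).
Qed.

Lemma near_cmap c p (V : set 'rV[C]_n) : cdom c p -> nbhs (cmap c p) V ->
  \forall q \near p, cdom c q /\ V (cmap c q).
Proof.
move=> cp pV.
have cont : {in cdom c, continuous (cmap c)}.
  by rewrite -(continuous_open_subspace _ (cdom_open c)); exact: cmap_cont.
have H1 : nbhs p (cmap c @^-1` V) by apply: cont; rewrite ?inE.
have H2 : nbhs p (cdom c) by apply: open_nbhs_nbhs; split; [exact: cdom_open|].
by apply: (nbhs_imply2 H2 H1).
Qed.

Lemma holo_near_incoord c p U Psi : atlas P c -> cdom c p -> open U -> U p ->
  holomorphic_on U Psi -> holo_near (incoord c Psi) (cmap c p).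
Proof.
move=> Ac cp oU Up hPsi.
have pU : nbhs p U by exact: open_nbhs_nbhs.
apply: (nbhs_imply (near_cinv cp pU)) => x [cx xE Ux].
by rewrite -xE; exact: hPsi.
Qed.

Section Jacobian.
Variables (U : set P) (Phi : 'I_n -> P -> C).
Hypotheses (oU : open U) (hPhi : forall i, holomorphic_on U (Phi i)).

Definition jac c q : C := dwedge (fun i => incoord c (Phi i)) id (cmap c q).

(** By the chain rule the two determinants differ by the Jacobian of the change of
    coordinates. *)
Lemma jac_change c d q : atlas P c -> atlas P d -> cdom c q -> cdom d q -> U q ->
  jac d q = 0 -> jac c q = 0.
Proof.
move=> Ac Ad cq dq Uq d0; rewrite /jac /dwedge.
pose T x := cmap d (cinv c x).
have TE : T (cmap c q) = cmap d q by rewrite /T cmapK.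
rewrite (_ : \matrix_(_, _) _ =
  (\matrix_(i, k) partial k (incoord d (Phi i)) (cmap d q)) *m
  (\matrix_(k, j) partial j (fun x => T x 0 k) (cmap c q))).
  by rewrite det_mulmx [X in X * _]d0 mul0r.
rewrite mulmx_matrixE; apply: eq_mx => i j; rewrite -TE -partial_comp.
- apply: near_eq_partial.
  have dn : nbhs q (cdom d) by apply: open_nbhs_nbhs; split; [exact: cdom_open|].
  apply: (nbhs_imply (near_cinv cq dn)) => x [cx xE dx].
  by rewrite /= /incoord /T cmapK.
- by rewrite TE; apply: hPhi.
- by move=> k; exact: (atlas_compatible Ac Ad).
Qed.

Definition jac_zeros : set P :=
  [set q | U q /\ exists2 c, atlas P c /\ cdom c q & jac c q = 0].

Lemma jac_zerosE c q : atlas P c -> cdom c q -> U q -> jac_zeros q <-> jac c q = 0.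
Proof.
move=> Ac cq Uq; split=> [[_ [d [Ad dq] d0]]|c0]; last by split=> //; exists c.
exact: jac_change d0.
Qed.

Lemma near_jac_zeros c q : atlas P c -> cdom c q -> U q ->
  nbhs q jac_zeros <->
  \forall x \near cmap c q, dwedge (fun i => incoord c (Phi i)) id x = 0.
Proof.
move=> Ac cq Uq; have qU : nbhs q U by exact: open_nbhs_nbhs.
split=> [qZ|cZ].
  apply: (nbhs_imply2 (near_cinv cq qZ) (near_cinv cq qU)) => x [cx xE Zx] [_ _ Ux].
  by have /(jac_zerosE Ac cx Ux) := Zx; rewrite /jac xE.
apply: (nbhs_imply2 (near_cmap cq cZ) qU) => y [cy y0] Uy.
exact/(jac_zerosE Ac cy Uy).
Qed.

(** The points of [U] at which the germ of the Jacobian is zero form a set that is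
    closed in [U], by [zero_accum_near0]; it is open by construction. *)
Lemma jac_zeros_closed p : U p -> closure (interior jac_zeros) p -> nbhs p jac_zeros.
Proof.
move=> Up pZ; have [c Ac cp] := atlas_cover p.
apply/(near_jac_zeros Ac cp Up); apply: zero_accum_near0.
  apply: holo_near_det => i j; apply: holo_near_partial.
  exact: (holo_near_incoord Ac cp oU Up (hPhi i)).
move=> V pV; have pU : nbhs p U by exact: open_nbhs_nbhs.
have [q [Zq [[cq Vq] Uq]]] := pZ _ (filterI (near_cmap cp pV) pU).
by exists (cmap c q) => //; apply/(near_jac_zeros Ac cq Uq).
Qed.

(** Otherwise zero germs fill the connected set [U], up to the point where some
    coefficient of the [n]-form is non-zero. *)
Lemma jac_germ_neq0 p0 : connected U -> U p0 ->
  (exists c p J, [/\ atlas P c, cdom c p, U p &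
     dwedge (fun i => incoord c (Phi i)) J (cmap c p) != 0]) ->
  forall c, atlas P c -> cdom c p0 ->
  ~ \forall x \near cmap c p0, dwedge (fun i => incoord c (Phi i)) id x = 0.
Proof.
move=> conn Up0 [d [p [J [Ad dp Up /eqP dJ]]]] c Ac cp0.
move=> /(near_jac_zeros Ac cp0 Up0) Z0.
have WU : U `&` interior jac_zeros = U.
  apply: conn; first by exists p0.
    by exists (interior jac_zeros) => //; exact: open_interior.
  exists (closure (interior jac_zeros)); first exact: closed_closure.
  apply/seteqP; split=> [q [Uq Zq]|q [Uq Zq]]; split=> //; first exact: subset_closure.
  exact: jac_zeros_closed.
have [_ /nbhs_singleton Zp] : (U `&` interior jac_zeros) p by rewrite WU.
apply: dJ; apply: dwedge_eq0; exact/(jac_zerosE Ad dp Up).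
Qed.

End Jacobian.

End Charts.

(** * Linearization of the Poisson structure *)

Section Linearization.
Context {R : realType} {n : nat} (P : complex_manifold R n).
Local Notation C := (Cx R).
Variables (pi : poisson_structure P) (z : chart R n P).
Hypothesis hz : atlas P z.

Let coord (i : 'I_n) : P -> C := fun q => cmap z q 0 i.

Lemma holomorphic_coord i : holomorphic_on (cdom z) (coord i).
Proof. by move=> c p Ac cp zp; exact: (atlas_compatible Ac hz). Qed.

Lemma dchart_coord i j q : cdom z q -> dchart z i (coord j) q = (j == i)%:R.
Proof.
move=> zq; rewrite -(partial_coord i j (cmap z q)); apply: near_eq_partial.
have zn : nbhs q (cdom z) by apply: open_nbhs_nbhs; split; [exact: cdom_open|].
by apply: (nbhs_imply (near_cinv zq zn)) => x [_ xE _]; rewrite /incoord /coord xE.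
Qed.

Lemma bracket_coord i j q : cdom z q -> bracket pi z (coord i) (coord j) q = bv pi z q i j.
Proof.
move=> zq; rewrite -[RHS]sum_delta2; apply: eq_bigr => a _; apply: eq_bigr => b _.
by rewrite (dchart_coord a i zq) (dchart_coord b j zq).
Qed.

Lemma dlinear_coord i p : cdom z p -> dlinear z p (coord i) = mpolyX C (mnm1 i).
Proof.
move=> zp; rewrite /dlinear (bigD1 i)//= (dchart_coord i i zp) eqxx scale1r.
rewrite big1 ?addr0// => j ji.
by rewrite (dchart_coord j i zp) eq_sym (negPf ji) scale0r.
Qed.

Lemma poly_bracketXX (w : 'M[mpoly n C]_n) i j :
  poly_bracket w (mpolyX C (mnm1 i)) (mpolyX C (mnm1 j)) = w i j.
Proof.
have dX (k l : 'I_n) : mderiv k (mpolyX C (mnm1 l)) = (l == k)%:R.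
  rewrite mderivX mnm1E; case: eqP => [->|]; last by rewrite scale0r.
  rewrite (_ : mnm_sub _ _ = mnm0) ?mpolyX0 ?scale1r//.
  by apply/mnmP => m; rewrite mnmBE subnn mnm0E.
rewrite -[RHS]sum_delta2; apply: eq_bigr => a _; apply: eq_bigr => b _.
by rewrite (dX a i) (dX b j).
Qed.

Variables (p0 : P) (pi0 : 'M[mpoly n C]_n).
Hypotheses (zp0 : cdom z p0) (z0 : cmap z p0 = 0) (pi_p0 : vanishes_at pi p0).
Hypothesis hpi0 : is_linearization pi z p0 pi0.

(** The hypothesis on [pi0], applied to the coordinate functions, says that
    [pi0 i j] is the differential at [p0] of the component [{z_i, z_j}] of [pi]. *)
Lemma ord_ge_linearization i j :
  ord_ge (fun x => bv pi z (cinv z x) i j - meval ((x - 0) 0) (pi0 i j)) 0 2.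
Proof.
have zn : nbhs p0 (cdom z) by apply: open_nbhs_nbhs; split; [exact: cdom_open|].
have [_ /(_ (cdom z) (coord i) (coord j) (cdom_open z) zp0)] := hpi0.
move=> /(_ (holomorphic_coord i) (holomorphic_coord j)).
rewrite !dlinear_coord// poly_bracketXX => ->.
pose v := incoord z (fun p => bv pi z p i j).
have [c vc] : holomorphic_at v 0 by rewrite -z0; exact: (bv_holomorphic pi hz i j).
have v0 : v 0 = 0 by rewrite /v /incoord -z0 cmapK// (pi_p0 hz zp0) mxE.
have dE k : dchart z k (bracket pi z (coord i) (coord j)) p0 = c (mnm1 k).
  rewrite -(has_expansion_partial_at k vc) /dchart -z0; apply: near_eq_partial.
  apply: (nbhs_imply (near_cinv zp0 zn)) => x [_ _ zx].
  by rewrite /incoord bracket_coord.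
apply: ord_ge_eqfun (has_expansion_linear vc) => x.
rewrite v0 subr0 /v /incoord; congr (_ - _); rewrite /dlinear raddf_sum /=.
by apply: eq_bigr => k _; rewrite mevalZ mevalXU dE.
Qed.

End Linearization.

(** * Degree of the log-volume form and integrability *)

Theorem theoremA (R : realType) (n : nat) (P : complex_manifold R n)
    (pi : poisson_structure P) (p0 : P) (z : chart R n P)
    (pi0 : 'M[mpoly n (Cx R)]_n) (Phi : 'I_n -> P -> Cx R)
    (hz : atlas P z) (hzp0 : cdom z p0) (hz0 : cmap z p0 = 0)
    (hpi : vanishes_at pi p0)
    (hpi0 : is_linearization pi z p0 pi0)
    (hPhi : log_canonical_system pi p0 Phi) :
  let phi := fun i : 'I_n => incoord z (Phi i) in
  let deg_mu : rat := (log_volume_low_deg phi 0)%:~R in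
  let half_rk : rat := (poisson_rank pi0)%:R / 2 in
  (deg_mu <= half_rk <-> deg_mu = half_rk) /\
  (deg_mu = half_rk ->
   exists s : seq (mpoly n (Cx R)),
     poly_integrable_system pi0 s /\
     {subset s <= [seq low (phi i) 0 | i <- enum 'I_n]}).
Proof.
move=> phi; have [U [[oU cU Up0] [hU log_can nondeg]]] := hPhi.
have zn : nbhs p0 U by exact: open_nbhs_nbhs.
apply: (@log_canonical_local R n phi _ _ (fun i j x => bv pi z (cinv z x) i j) pi0).
- by move=> i; rewrite -hz0; exact: (holo_near_incoord hz hzp0 oU Up0 (hU i)).
- rewrite -hz0; exact: (jac_germ_neq0 oU hU cU Up0 nondeg hz hzp0).
- by have [[_ pi0_lin _] _] := hpi0.
- by move=> i j; exact: (ord_ge_linearization hz hzp0 hz0 hpi hpi0 i j).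
move=> i j; have [l ll] := log_can i j; exists l.
rewrite -hz0; apply: (nbhs_imply (near_cinv hzp0 zn)) => x [zx xE Ux].
have := ll z (cinv z x) hz zx Ux; rewrite /bracket /bracket_in /dchart xE.
exact.
Qed.
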